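(* Let $q:\mathbb{D}_e^2\to\mathbb{C}$ be a holomorphic function. Then there is a univalent function $\psi\in\Sigma$ such that $$q(z,w)=\log\frac{\psi(z)-\psi(w)}{z-w},\qquad(z,w)\in\mathbb{D}_e^2,$$ if and only if both of the following hold: (a) $q(\infty,w)=0$ for each $w\in\mathbb{D}_e$; (b) $q$ solves the Riccati equation $$\partial_z^2q(z,w)+(\partial_zq(z,w))^2+\frac{2}{z-w}\big(\partial_zq(z,w)-(\oslash\partial_zq)(z)\big)-2(\oslash\partial_zq)(z)\,\partial_zq(z,w)=0$$ for $(z,w)\in\mathbb{D}_e^2$.
   Context: $\mathbb{D}_e=\{z\in\mathbb{C}:|z|>1\}$. $\Sigma$ is the class of univalent (injective holomorphic) functions $\psi:\mathbb{D}_e\to\mathbb{C}$ with Laurent expansion $\psi(z)=z+b_0+b_1z^{-1}+\cdots$. For $\psi\in\Sigma$, $\log\frac{\psi(z)-\psi(w)}{z-w}$ denotes the holomorphic function on $\mathbb{D}_e^2$ (quotient read as $\psi'(z)$ on $z=w$) given by the branch of the logarithm vanishing when $z=\infty$ or $w=\infty$; it is the Dirichlet operator symbol $\mathscr{Q}_e[\Gamma_\psi]$ of the Grunsky operator $\Gamma_\psi$. $\oslash$ denotes diagonal restriction: $(\oslash f)(z)=f(z,z)$, so $(\oslash\partial_zq)(z)=(\partial_zq)(z,z)$. Condition (a) means that $q(z,w)\to0$ as $|z|\to\infty$ for each fixed $w\in\mathbb{D}_e$. In (b) the quotient with $z-w$ is understood via its removable singularity at $z=w$. *)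

(* Defs.v *)
From Stdlib Require Import Reals Lra.
From Coquelicot Require Import Coquelicot.
Local Open Scope R_scope.
Local Open Scope C_scope.

(* Functions on D_e are represented by total functions on C; only their values
   on D_e matter below (D_e is open, and limits at infinity only see large |z|). *)
Definition D_e (z : C) : Prop := (1 < Cmod z)%R.

Definition Cexp (z : C) : C :=
  ((exp (Re z) * cos (Im z))%R, (exp (Re z) * sin (Im z))%R).

Definition C_infty (P : C -> Prop) : Prop :=
  exists M : R, forall z : C, (M < Cmod z)%R -> P z.

Global Instance C_infty_proper : ProperFilter C_infty.
Proof.
split.
- intros P [M HM].
  exists (RtoC (Rabs M + 1)%R); apply HM.
  rewrite Cmod_R, Rabs_pos_eq.
  + generalize (Rle_abs M); lra.
  + generalize (Rabs_pos M); lra.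
- split.
  + now exists 0%R.
  + intros P Q [M HM] [N HN]; exists (Rmax M N); intros z Hz; split.
    * apply HM; apply Rle_lt_trans with (2 := Hz); apply Rmax_l.
    * apply HN; apply Rle_lt_trans with (2 := Hz); apply Rmax_r.
  + intros P Q HPQ [M HM]; exists M; auto.
Qed.

Definition tends_to_0_at_infty (f : C -> C) : Prop :=
  filterlim f C_infty (locally (T := C_UniformSpace) (RtoC 0)).

Definition holomorphic_De (f : C -> C) : Prop :=
  forall z : C, D_e z ->
    @ex_derive C_AbsRing C_NormedModule f z.

Definition C2_NormedModule : NormedModule C_AbsRing :=
  prod_NormedModule C_AbsRing
    (AbsRing_NormedModule C_AbsRing) (AbsRing_NormedModule C_AbsRing).

(* Complex (Frechet) differentiability in (z, w) jointly. *)
Definition holomorphic_De2 (q : C -> C -> C) : Prop :=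
  forall z w : C, D_e z -> D_e w ->
    @ex_filterdiff C_AbsRing C2_NormedModule C_NormedModule
      (fun p => q (fst p) (snd p)) (locally (T := C2_NormedModule) (z, w)).

Definition univalent_De (psi : C -> C) : Prop :=
  holomorphic_De psi /\
  forall z w : C, D_e z -> D_e w -> psi z = psi w -> z = w.

Definition class_Sigma (psi : C -> C) : Prop :=
  univalent_De psi /\
  exists b : nat -> C, forall z : C, D_e z ->
    @is_series C_AbsRing C_NormedModule (fun n => b n / z ^ n) (psi z - z).

Definition diff_quotient (psi : C -> C) (z w : C) : C :=
  if Ceq_dec z w then C_derive psi z else (psi z - psi w) / (z - w).

(* L is the branch of log ((psi z - psi w) / (z - w)) on D_e^2 that vanishes
   when z or w is infinity. *)
Definition is_log_diff_quotient (psi : C -> C) (L : C -> C -> C) : Prop :=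
  holomorphic_De2 L /\
  (forall z w : C, D_e z -> D_e w -> Cexp (L z w) = diff_quotient psi z w) /\
  (forall w : C, D_e w -> tends_to_0_at_infty (fun z => L z w)) /\
  (forall z : C, D_e z -> tends_to_0_at_infty (fun w => L z w)).

Definition d_z (q : C -> C -> C) (z w : C) : C := C_derive (fun t => q t w) z.

Definition oslash (f : C -> C -> C) (z : C) : C := f z z.

(* f z / (z - w), with the value at z = w supplied by the limit z -> w,
   which exists when f is holomorphic near w and f w = 0. *)
Definition removable_quotient (f : C -> C) (w z : C) : C :=
  if Ceq_dec z w then C_lim (fun t => f t / (t - w)) w else f z / (z - w).

Definition riccati (q : C -> C -> C) : Prop :=
  forall z w : C, D_e z -> D_e w ->
    d_z (d_z q) z w + d_z q z w ^ 2
    + 2 * removable_quotient (fun t => d_z q t w - oslash (d_z q) t) w z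
    - 2 * oslash (d_z q) z * d_z q z w = 0.

(* Main.v *)
Require Import Defs.
From Stdlib Require Import Reals Lra Lia.
From Coquelicot Require Import Coquelicot.
Local Open Scope R_scope.
Local Open Scope C_scope.

(* For fixed [w] put [u_w z = (z - w) exp (q z w)].  Multiplied by this function, the Riccati
   equation becomes the linear equation [u_w'' = 2 P u_w'], where [P z] is the value of [d_z q] at
   [(z, z)], and on the diagonal [u_w' w = exp (q w w)] does not vanish.  All the [u_w'] solve the
   same first-order linear equation on the connected set [D_e], so they are proportional and
   without zeros.  Condition (a) gives [u_w z / z -> 1] at infinity, so the factor is [1] and
   [u_w z = psi z - psi w] with [psi = u_2].  Conversely, this identity determines [u_w'] and
   [u_w''] in terms of [psi' = exp (q z z)] and [psi''], and [P = psi'' / (2 psi')].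
   The Laurent expansion of [psi] is the Taylor expansion of [t psi (1/t)], continuous at [0].
   The complex analysis (derivatives of holomorphic functions, Taylor series with a removable
   singularity at the centre) rests on Goursat's theorem for rectangles, transported to annuli by
   the exponential map. *)

(** * Complex continuity and differentiability *)

(** The Riccati equation contains a second derivative and a limit on the diagonal, whereas the
    hypothesis on [q] provides a single complex derivative at each point; this gap is what Goursat's
    theorem and Cauchy's formula fill. Condition (a) is only a limit, so [t * psi (/ t)] is known to
    be continuous at [0] and nothing more; accordingly Cauchy's formula and the Taylor expansion ask
    for differentiability only away from [0]. Univalence comes for free, since
    [u_w z = (z - w) exp (q z w)] vanishes only at [z = w]. The decay of [q z w] as [w] goes to
    infinity is not part of (a); it follows from the symmetry of [q], itself a consequence of
    [u_w z = psi z - psi w]. *)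

Definition ccont (f : C -> C) (z : C) : Prop :=
  forall e : R, (0 < e)%R -> exists d : R, (0 < d)%R /\
    forall w, Cmod (w - z) < d -> Cmod (f w - f z) < e.

(* Caratheodory's form of the complex derivative; it makes the product and chain rules algebraic. *)
Definition cder (f : C -> C) (z d : C) : Prop :=
  exists phi : C -> C, ccont phi z /\ phi z = d /\
    forall w, f w = f z + phi w * (w - z).

Lemma Cmod_minus_sym (a b : C) : Cmod (a - b) = Cmod (b - a).
Proof. rewrite <- Cmod_opp. f_equal. ring. Qed.

Lemma Cmod_minus_triangle (a b c : C) : Cmod (a - c) <= Cmod (a - b) + Cmod (b - c).
Proof. replace (a - c) with ((a - b) + (b - c)) by ring. apply Cmod_triangle. Qed.

Lemma Cmod_le_minus (a b : C) : Cmod a <= Cmod b + Cmod (a - b).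
Proof. replace a with (b + (a - b)) at 1 by ring. apply Cmod_triangle. Qed.

Lemma Cmod_minus_self (z : C) : Cmod (z - z) = 0.
Proof. replace (z - z) with (RtoC 0) by ring. apply Cmod_0. Qed.

Lemma Cmod_minus_gt_0 (a b : C) : a <> b -> 0 < Cmod (a - b).
Proof. intros H. apply Cmod_gt_0. now apply Cminus_eq_contra. Qed.

Lemma ccont_const (c z : C) : ccont (fun _ => c) z.
Proof. intros e He; exists 1%R; split; [lra|]. intros w _; now rewrite Cmod_minus_self. Qed.

Lemma ccont_id (z : C) : ccont (fun w => w) z.
Proof. intros e He; exists e; auto. Qed.

Lemma ccont_plus (f g : C -> C) (z : C) :
  ccont f z -> ccont g z -> ccont (fun w => f w + g w) z.
Proof.
intros Hf Hg e He.
destruct (Hf (e/2)%R) as [d [Hd Kf]]; [lra|].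
destruct (Hg (e/2)%R) as [d' [Hd' Kg]]; [lra|].
exists (Rmin d d'); split; [now apply Rmin_pos|]. intros w Hw.
specialize (Kf w (Rlt_le_trans _ _ _ Hw (Rmin_l _ _))).
specialize (Kg w (Rlt_le_trans _ _ _ Hw (Rmin_r _ _))).
replace (f w + g w - (f z + g z)) with ((f w - f z) + (g w - g z)) by ring.
pose proof (Cmod_triangle (f w - f z) (g w - g z)); lra.
Qed.

Lemma ccont_mult (f g : C -> C) (z : C) :
  ccont f z -> ccont g z -> ccont (fun w => f w * g w) z.
Proof.
intros Hf Hg e He.
pose proof (Cmod_ge_0 (f z)) as Pf; pose proof (Cmod_ge_0 (g z)) as Pg.
(* The bound [1] makes the product of the two increments at most [b], so the total error is at most
   [b * (1 + Cmod (f z) + Cmod (g z))], that is at most [e / 2]. *)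
set (b := Rmin 1 (e / (2 * (1 + Cmod (f z) + Cmod (g z))))%R).
assert (Hb : 0 < b).
{ apply Rmin_pos; [lra|]. apply Rdiv_lt_0_compat; lra. }
assert (Hb1 : b <= 1) by apply Rmin_l.
assert (Hb2 : (b * (1 + Cmod (f z) + Cmod (g z)) <= e / 2)%R).
{ apply Rle_trans with ((e / (2 * (1 + Cmod (f z) + Cmod (g z)))) * (1 + Cmod (f z) + Cmod (g z)))%R.
  - apply Rmult_le_compat_r; [lra | apply Rmin_r].
  - apply Req_le; field; lra. }
destruct (Hf b Hb) as [d [Hd Kf]].
destruct (Hg b Hb) as [d' [Hd' Kg]].
exists (Rmin d d'); split; [now apply Rmin_pos|]. intros w Hw.
specialize (Kf w (Rlt_le_trans _ _ _ Hw (Rmin_l _ _))).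
specialize (Kg w (Rlt_le_trans _ _ _ Hw (Rmin_r _ _))).
replace (f w * g w - f z * g z)
  with ((f w - f z) * (g w - g z) + ((f w - f z) * g z + f z * (g w - g z))) by ring.
eapply Rle_lt_trans; [apply Cmod_triangle|].
eapply Rle_lt_trans; [apply Rplus_le_compat_l, Cmod_triangle|].
rewrite !Cmod_mult.
pose proof (Cmod_ge_0 (f w - f z)); pose proof (Cmod_ge_0 (g w - g z)).
nra.
Qed.

Lemma ccont_opp (f : C -> C) (z : C) : ccont f z -> ccont (fun w => - f w) z.
Proof.
intros Hf e He; destruct (Hf e He) as [d [Hd K]]; exists d; split; auto.
intros w Hw. replace (- f w - - f z) with (- (f w - f z)) by ring.
rewrite Cmod_opp; auto.
Qed.

Lemma ccont_minus (f g : C -> C) (z : C) :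
  ccont f z -> ccont g z -> ccont (fun w => f w - g w) z.
Proof. intros Hf Hg; apply ccont_plus; [assumption | now apply ccont_opp]. Qed.

Lemma ccont_comp (f g : C -> C) (z : C) :
  ccont g (f z) -> ccont f z -> ccont (fun w => g (f w)) z.
Proof.
intros Hg Hf e He. destruct (Hg e He) as [d [Hd K]].
destruct (Hf d Hd) as [d' [Hd' K']]. exists d'; auto.
Qed.

Lemma ccont_ext_loc (f g : C -> C) (z : C) (r : R) : 0 < r ->
  (forall w, Cmod (w - z) < r -> f w = g w) -> ccont f z -> ccont g z.
Proof.
intros Hr E Hf e He. destruct (Hf e He) as [d [Hd K]].
exists (Rmin d r); split; [now apply Rmin_pos|]. intros w Hw.
rewrite <- !E.
- apply K. apply Rlt_le_trans with (1 := Hw), Rmin_l.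
- rewrite Cmod_minus_self; auto.
- apply Rlt_le_trans with (1 := Hw), Rmin_r.
Qed.

Lemma ccont_neq (f : C -> C) (z c : C) : ccont f z -> f z <> c ->
  exists d, 0 < d /\ forall w, Cmod (w - z) < d -> f w <> c.
Proof.
intros Hf Hz. destruct (Hf (Cmod (f z - c))) as [d [Hd K]].
{ now apply Cmod_minus_gt_0. }
exists d; split; auto. intros w Hw E. specialize (K w Hw).
rewrite E, Cmod_minus_sym in K. lra.
Qed.

Lemma ccont_inv (z : C) : z <> 0 -> ccont Cinv z.
Proof.
intros Hz e He.
assert (P : 0 < Cmod z) by now apply Cmod_gt_0.
set (m := Cmod z) in *.
(* The first bound keeps [Cmod w] above [m / 2]; with the second one, [Cmod (z - w) / (Cmod w * m)]
   is less than [e]. *)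
exists (Rmin (m/2) (e * m * m / 2))%R; split.
{ apply Rmin_pos; [lra|]. assert (0 < e * m * m)%R by (repeat apply Rmult_lt_0_compat; lra). lra. }
intros w Hw.
assert (H1 : (Cmod (w - z) < m/2)%R) by (eapply Rlt_le_trans; [exact Hw|apply Rmin_l]).
assert (H2 : (Cmod (w - z) < e * m * m/2)%R) by (eapply Rlt_le_trans; [exact Hw|apply Rmin_r]).
assert (H3 : (m / 2 < Cmod w)%R).
{ pose proof (Cmod_le_minus z w). rewrite Cmod_minus_sym in H. unfold m in *; lra. }
assert (w <> 0). { intros ->; rewrite Cmod_0 in H3; lra. }
replace (/ w - / z) with ((z - w) / (w * z)) by (field; auto).
rewrite Cmod_div by now apply Cmult_neq_0.
rewrite Cmod_mult, Cmod_minus_sym. fold m.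
apply Rmult_lt_reg_r with (Cmod w * m)%R; [apply Rmult_lt_0_compat; lra|].
unfold Rdiv; rewrite Rmult_assoc, Rinv_l, Rmult_1_r.
2: apply Rgt_not_eq, Rmult_lt_0_compat; lra.
apply Rlt_trans with (1 := H2).
assert (0 < e * m)%R by (apply Rmult_lt_0_compat; lra). nra.
Qed.

Lemma ccont_div (f g : C -> C) (z : C) : g z <> 0 ->
  ccont f z -> ccont g z -> ccont (fun w => f w / g w) z.
Proof.
intros H Hf Hg. apply ccont_mult; [assumption|].
apply (ccont_comp g Cinv); auto. now apply ccont_inv.
Qed.

Lemma cder_ccont (f : C -> C) (z d : C) : cder f z d -> ccont f z.
Proof.
intros [phi [Hc [Hd E]]].
apply (ccont_ext_loc (fun w => f z + phi w * (w - z)) f z 1); [lra | |].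
- intros w _; symmetry; apply E.
- apply ccont_plus; [apply ccont_const|]. apply ccont_mult; [assumption|].
  apply ccont_minus; [apply ccont_id | apply ccont_const].
Qed.

Lemma cder_const (c z : C) : cder (fun _ => c) z 0.
Proof. exists (fun _ => RtoC 0); repeat split; [apply ccont_const | intros; ring]. Qed.

Lemma cder_id (z : C) : cder (fun w => w) z 1.
Proof. exists (fun _ => RtoC 1); repeat split; [apply ccont_const | intros; ring]. Qed.

Lemma cder_plus (f g : C -> C) (z a b : C) :
  cder f z a -> cder g z b -> cder (fun w => f w + g w) z (a + b).
Proof.
intros [p [Hp [Ea Ep]]] [q [Hq [Eb Eq]]]. exists (fun w => p w + q w); repeat split.
- now apply ccont_plus.
- now rewrite Ea, Eb.
- intros w; rewrite (Ep w), (Eq w); ring.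
Qed.

Lemma cder_mult (f g : C -> C) (z a b : C) :
  cder f z a -> cder g z b -> cder (fun w => f w * g w) z (a * g z + f z * b).
Proof.
intros Hf Hg. pose proof (cder_ccont _ _ _ Hg) as Cg.
destruct Hf as [p [Hp [Ea Ep]]]. destruct Hg as [q [Hq [Eb Eq]]].
exists (fun w => p w * g w + f z * q w); repeat split.
- apply ccont_plus; [now apply ccont_mult|]. apply ccont_mult; [apply ccont_const | assumption].
- now rewrite Ea, Eb.
- intros w; rewrite (Ep w), (Eq w); ring.
Qed.

Lemma cder_comp (f g : C -> C) (z a b : C) :
  cder g (f z) b -> cder f z a -> cder (fun w => g (f w)) z (b * a).
Proof.
intros Hg Hf. pose proof (cder_ccont _ _ _ Hf) as Cf.
destruct Hf as [p [Hp [Ea Ep]]]. destruct Hg as [q [Hq [Eb Eq]]].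
exists (fun w => q (f w) * p w); repeat split.
- apply ccont_mult; [|assumption]. now apply ccont_comp.
- now rewrite Ea, Eb.
- intros w; rewrite (Eq (f w)). rewrite (Ep w) at 2. ring.
Qed.

Lemma cder_eq (f : C -> C) (z a b : C) : a = b -> cder f z a -> cder f z b.
Proof. now intros ->. Qed.

Lemma cder_opp (f : C -> C) (z a : C) : cder f z a -> cder (fun w => - f w) z (- a).
Proof.
intros [p [Hp [Ea Ep]]]. exists (fun w => - p w); repeat split.
- now apply ccont_opp.
- now rewrite Ea.
- intros w; rewrite (Ep w); ring.
Qed.

Lemma cder_minus (f g : C -> C) (z a b : C) :
  cder f z a -> cder g z b -> cder (fun w => f w - g w) z (a - b).
Proof. intros Hf Hg. apply cder_plus; [assumption | now apply cder_opp]. Qed.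

(** Caratheodory's factor is forced at every [w <> z], so only its continuity at [z] is in question.
    This turns [cder], whose identity is asked for all [w], into a visibly local notion, as
    [cder_ext_loc] requires. *)
Lemma cder_slope (f : C -> C) (z d : C) :
  cder f z d <->
  ccont (fun w => if Ceq_dec w z then d else (f w - f z) / (w - z)) z.
Proof.
split.
- intros [p [Hp [Ed E]]]. apply (ccont_ext_loc p _ z 1); [lra | | assumption].
  intros w _. destruct (Ceq_dec w z) as [->|N]; [assumption|].
  rewrite (E w). field. now apply Cminus_eq_contra.
- intros H. exists (fun w => if Ceq_dec w z then d else (f w - f z) / (w - z)).
  repeat split; [assumption | |].
  + destruct (Ceq_dec z z); congruence.
  + intros w. destruct (Ceq_dec w z) as [->|N]; [ring|].
    field. now apply Cminus_eq_contra.
Qed.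

Lemma cder_ext_loc (f g : C -> C) (z d : C) (r : R) : 0 < r ->
  (forall w, Cmod (w - z) < r -> f w = g w) -> cder f z d -> cder g z d.
Proof.
intros Hr E Hf. apply cder_slope. apply cder_slope in Hf.
apply (ccont_ext_loc _ _ z r Hr) with (2 := Hf).
intros w Hw. rewrite (E w Hw), (E z); [reflexivity|]. now rewrite Cmod_minus_self.
Qed.

(** Two Caratheodory factors coincide off [z], while different values at [z] would keep them apart
    near [z] by continuity; the point [z + d/2] exhibits the contradiction. *)
Lemma cder_unique (f : C -> C) (z a b : C) : cder f z a -> cder f z b -> a = b.
Proof.
intros [p [Hp [Ea Ep]]] [q [Hq [Eb Eq]]].
destruct (Ceq_dec a b) as [|N]; [assumption|exfalso].
destruct (ccont_neq (fun w => p w - q w) z 0) as [d [Hd K]].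
- now apply ccont_minus.
- rewrite Ea, Eb. now apply Cminus_eq_contra.
- assert (Hm : Cmod (z + (d/2)%R - z) = (d/2)%R).
  { replace (z + (d/2)%R - z) with (RtoC (d/2)) by ring.
    rewrite Cmod_R, Rabs_pos_eq; lra. }
  apply (K (z + (d/2)%R)); [lra|].
  assert (H : (p (z + (d/2)%R) - q (z + (d/2)%R)) * (z + (d/2)%R - z) = 0).
  { assert (H : f z + p (z + (d/2)%R) * (z + (d/2)%R - z) = f z + q (z + (d/2)%R) * (z + (d/2)%R - z)).
    { now rewrite <- Ep, <- Eq. }
    apply (f_equal (fun x => x - f z)) in H.
    transitivity ((f z + p (z + (d/2)%R) * (z + (d/2)%R - z) - f z) - (f z + q (z + (d/2)%R) * (z + (d/2)%R - z) - f z)); [ring|].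
    rewrite H; ring. }
  destruct (Ceq_dec (p (z + (d/2)%R) - q (z + (d/2)%R)) 0) as [|N']; [assumption|].
  exfalso; revert H; apply Cmult_neq_0; [assumption|].
  apply Cmod_gt_0; rewrite Hm; lra.
Qed.

Lemma cder_inv (z : C) : z <> 0 -> cder Cinv z (- / (z * z)).
Proof.
intros Hz. apply (cder_ext_loc (fun w => if Ceq_dec w 0 then 0 else / w) _ _ _ (Cmod z)).
{ now apply Cmod_gt_0. }
{ intros w Hw. destruct (Ceq_dec w 0) as [->|]; [|reflexivity].
  replace (0 - z) with (- z) in Hw by ring. rewrite Cmod_opp in Hw; lra. }
apply cder_slope.
apply (ccont_ext_loc (fun w => - / (w * z)) _ z (Cmod z)).
{ now apply Cmod_gt_0. }
- intros w Hw. assert (w <> 0).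
  { intros ->. replace (0 - z) with (- z) in Hw by ring. rewrite Cmod_opp in Hw; lra. }
  destruct (Ceq_dec w z) as [->|N]; [reflexivity|].
  destruct (Ceq_dec w 0); [contradiction|]. destruct (Ceq_dec z 0); [contradiction|].
  field. repeat split; auto. now apply Cminus_eq_contra.
- apply ccont_opp. apply (ccont_comp (fun w => w * z) Cinv).
  + now apply ccont_inv, Cmult_neq_0.
  + apply ccont_mult; [apply ccont_id | apply ccont_const].
Qed.

Lemma cder_div (f g : C -> C) (z a b : C) : g z <> 0 ->
  cder f z a -> cder g z b -> cder (fun w => f w / g w) z ((a * g z - f z * b) / (g z * g z)).
Proof.
intros H Hf Hg.
apply (cder_eq _ _ (a * / g z + f z * (- / (g z * g z) * b))); [field; assumption|].
apply (cder_mult f (fun w => / g w)); [exact Hf|].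
apply (cder_comp g Cinv); [now apply cder_inv | exact Hg].
Qed.

Lemma cder_of_bound (f : C -> C) (z d : C) :
  (forall e, 0 < e -> exists r, 0 < r /\ forall w, Cmod (w - z) < r ->
     Cmod (f w - f z - d * (w - z)) <= e * Cmod (w - z)) ->
  cder f z d.
Proof.
intros H. apply cder_slope. intros e He.
destruct (H (e/2)%R) as [r [Hr K]]; [lra|].
exists r; split; [assumption|]. intros w Hw.
destruct (Ceq_dec z z) as [_|]; [|congruence].
destruct (Ceq_dec w z) as [->|N]; [now rewrite Cmod_minus_self|].
specialize (K w Hw).
assert (N' := Cminus_eq_contra _ _ N). assert (P := Cmod_minus_gt_0 _ _ N).
replace ((f w - f z) / (w - z) - d) with ((f w - f z - d * (w - z)) / (w - z)) by (field; auto).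
rewrite Cmod_div by assumption.
apply Rle_lt_trans with (e / 2)%R; [|lra].
apply Rmult_le_reg_r with (Cmod (w - z)); [assumption|].
unfold Rdiv at 1. rewrite Rmult_assoc, Rinv_l, Rmult_1_r; lra.
Qed.

Lemma cder_is_derive (f : C -> C) (z d : C) :
  cder f z d <-> @is_derive C_AbsRing C_NormedModule f z d.
Proof.
split.
- intros Hd. split; [apply is_linear_scal_l|].
  intros x Hx e.
  assert (x = z) as -> by (symmetry; exact (is_filter_lim_locally_unique _ _ Hx)).
  destruct Hd as [p [Hp [Ed E]]].
  destruct (Hp e (cond_pos e)) as [r [Hr K]]. exists (mkposreal r Hr). intros y Hy.
  change (Cmod (f y - f z - (y - z) * d) <= e * Cmod (y - z)).
  rewrite (E y), <- Ed.
  replace (f z + p y * (y - z) - f z - (y - z) * p z) with ((p y - p z) * (y - z)) by ring.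
  rewrite Cmod_mult. apply Rmult_le_compat_r; [apply Cmod_ge_0|].
  apply Rlt_le, K. exact Hy.
- intros [_ H]. apply cder_of_bound. intros e He.
  destruct (H z (fun P HP => HP) (mkposreal _ He)) as [r K].
  exists r; split; [apply cond_pos|]. intros w Hw.
  rewrite (Cmult_comm d). exact (K w Hw).
Qed.

Lemma cder_C_derive (f : C -> C) (z d : C) : cder f z d -> C_derive f z = d.
Proof. intros H; apply is_C_derive_unique. now apply cder_is_derive. Qed.

(** * The exponential and integrals of complex-valued functions *)

Lemma Cmod_le_Re_Im (z : C) : (Cmod z <= Rabs (Re z) + Rabs (Im z))%R.
Proof.
replace z with (RtoC (Re z) + Ci * RtoC (Im z)) at 1.
- eapply Rle_trans; [apply Cmod_triangle|].
  rewrite Cmod_mult, Cmod_Ci, !Cmod_R. lra.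
- destruct z as [x y]; unfold Re, Im, Ci, RtoC, Cplus, Cmult; simpl. f_equal; ring.
Qed.

Lemma Im_le_Cmod (z : C) : Rabs (Im z) <= Cmod z.
Proof. apply Rle_trans with (2 := Rmax_Cmod z), Rmax_r. Qed.

Lemma Cexp_plus (z w : C) : Cexp (z + w) = Cexp z * Cexp w.
Proof.
destruct z as [x y], w as [u v]; unfold Cexp, Cmult, Cplus, Re, Im; simpl.
rewrite exp_plus, cos_plus, sin_plus. f_equal; ring.
Qed.

Lemma Cexp_0 : Cexp 0 = 1.
Proof. unfold Cexp, Re, Im; simpl. rewrite exp_0, cos_0, sin_0. unfold RtoC; f_equal; ring. Qed.

Lemma Cexp_neq_0 (z : C) : Cexp z <> 0.
Proof.
intros H. assert (E : Cexp (z + - z) = 1).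
{ replace (z + - z) with (RtoC 0) by ring. apply Cexp_0. }
rewrite Cexp_plus, H in E. apply C1_nz. rewrite <- E. ring.
Qed.

(** Clearing the denominator admits [h = 0]: the increment will be the real or the imaginary part of
    a complex one, and either may vanish. *)
Lemma derivable_pt_lim_bound (f : R -> R) (x l : R) : derivable_pt_lim f x l ->
  forall e, 0 < e -> exists d, 0 < d /\
    forall h, Rabs h < d -> (Rabs (f (x + h) - f x - l * h) <= e * Rabs h)%R.
Proof.
intros H e He. destruct (H e He) as [d K]. exists d; split; [apply cond_pos|].
intros h Hh. destruct (Req_dec h 0) as [->|N].
- rewrite Rplus_0_r, Rmult_0_r, Rabs_R0. replace (f x - f x - 0)%R with 0%R by ring.
  rewrite Rabs_R0; lra.
- specialize (K h N Hh).
  replace (f (x + h) - f x - l * h)%R with (((f (x + h) - f x) / h - l) * h)%R by (field; auto).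
  rewrite Rabs_mult. apply Rmult_le_compat_r; [apply Rabs_pos | lra].
Qed.

Lemma cder_Cexp_0 : cder Cexp 0 1.
Proof.
apply cder_of_bound. intros e He.
(* The errors below add up to at most [5 * k * Rabs x + 3 * k * Rabs y], which [e / 20] covers with
   room to spare; [k <= 1/2] keeps [Rabs (1 + x + r1)] below [2]. *)
set (k := Rmin (1/2) (e / 20)).
assert (Hk : 0 < k) by (apply Rmin_pos; [lra | lra]).
assert (Hk1 : (k <= 1/2)%R) by apply Rmin_l.
assert (Hk2 : (20 * k <= e)%R) by (generalize (Rmin_r (1/2) (e/20)); fold k; lra).
clearbody k.
destruct (derivable_pt_lim_bound _ _ _ (derivable_pt_lim_exp 0) k Hk) as [d1 [D1 K1]].
destruct (derivable_pt_lim_bound _ _ _ (derivable_pt_lim_cos 0) k Hk) as [d2 [D2 K2]].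
destruct (derivable_pt_lim_bound _ _ _ (derivable_pt_lim_sin 0) k Hk) as [d3 [D3 K3]].
assert (Hd : 0 < Rmin k (Rmin d1 (Rmin d2 d3))) by (repeat apply Rmin_pos; auto).
exists (Rmin k (Rmin d1 (Rmin d2 d3))); split; [assumption|]. intros h Hh.
replace (h - 0) with h in * by ring. rewrite Cexp_0, Cmult_1_l.
generalize (Rmin_l k (Rmin d1 (Rmin d2 d3))) (Rmin_r k (Rmin d1 (Rmin d2 d3)))
  (Rmin_l d1 (Rmin d2 d3)) (Rmin_r d1 (Rmin d2 d3)) (Rmin_l d2 d3) (Rmin_r d2 d3).
intros L1 L2 L3 L4 L5 L6.

pose proof (re_le_Cmod h) as Hx1. pose proof (Im_le_Cmod h) as Hy1.
specialize (K1 (Re h) ltac:(lra)). specialize (K2 (Im h) ltac:(lra)). specialize (K3 (Im h) ltac:(lra)).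
rewrite Rplus_0_l in K1, K2, K3. rewrite exp_0 in K1. rewrite cos_0, sin_0 in K2. rewrite sin_0, cos_0 in K3.
set (x := Re h) in *. set (y := Im h) in *.
set (r1 := (exp x - 1 - 1 * x)%R) in *. set (r2 := (cos y - 1 - -0 * y)%R) in *.
set (r3 := (sin y - 0 - 1 * y)%R) in *.
(* Substitute [exp x = 1 + x + r1], [cos y = 1 + r2] and [sin y = y + r3] into the two components
   and expand. *)
assert (E : Cexp h - 1 - h = ((r1 + r2 * (1 + x + r1))%R, (r3 + (x + r1) * (y + r3))%R)).
{ unfold Cexp, Cminus, Cplus, Copp, RtoC; simpl. fold x y.
  destruct h as [u v]; unfold Re, Im in x, y; simpl in x, y; subst x y.
  unfold r1, r2, r3; simpl; f_equal; ring. }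
rewrite E. eapply Rle_trans; [apply Cmod_le_Re_Im|]. unfold Re, Im; simpl.
assert (B1 : (Rabs x <= 1/2)%R) by lra. assert (B2 : (Rabs y <= k)%R) by lra.
pose proof (Rabs_pos x) as Px. pose proof (Rabs_pos y) as Py.
assert (A1 : (Rabs (r1 + r2 * (1 + x + r1)) <= k * Rabs x + k * Rabs y * 2)%R).
{ eapply Rle_trans; [apply Rabs_triang|]. apply Rplus_le_compat; [assumption|].
  rewrite Rabs_mult. apply Rmult_le_compat; try apply Rabs_pos; [assumption|].
  eapply Rle_trans; [apply Rabs_triang|].
  eapply Rle_trans; [apply Rplus_le_compat_r, Rabs_triang|]. rewrite Rabs_R1. nra. }
assert (A2 : (Rabs (r3 + (x + r1) * (y + r3)) <= k * Rabs y + (2 * Rabs x) * (2 * k))%R).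
{ eapply Rle_trans; [apply Rabs_triang|]. apply Rplus_le_compat; [assumption|].
  rewrite Rabs_mult. apply Rmult_le_compat; try apply Rabs_pos.
  - eapply Rle_trans; [apply Rabs_triang|]. nra.
  - eapply Rle_trans; [apply Rabs_triang|]. nra. }
nra.
Qed.

Lemma cder_Cexp (z : C) : cder Cexp z (Cexp z).
Proof.
apply (cder_ext_loc (fun w => Cexp z * Cexp (w - z)) _ _ _ 1); [lra| |].
- intros w _. rewrite <- Cexp_plus. f_equal. ring.
- apply (cder_eq _ _ (0 * Cexp (z - z) + Cexp z * (1 * (1 - 0)))); [ring|].
  apply (cder_mult (fun _ => Cexp z) (fun w => Cexp (w - z))); [apply cder_const|].
  apply (cder_comp (fun w => w - z) Cexp).
  + replace (z - z) with (RtoC 0) by ring. apply cder_Cexp_0.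
  + apply cder_minus; [apply cder_id | apply cder_const].
Qed.

(** * Integrals of complex-valued functions of a real variable *)

Definition CInt (g : R -> C) (a b : R) : C :=
  (RInt (fun t => Re (g t)) a b, RInt (fun t => Im (g t)) a b).

Definition rcont (g : R -> C) (t : R) : Prop :=
  continuous (fun t => Re (g t)) t /\ continuous (fun t => Im (g t)) t.

Lemma rcont_eps (g : R -> C) (t : R) :
  (forall e, 0 < e -> exists d, 0 < d /\ forall u, Rabs (u - t) < d -> Cmod (g u - g t) < e) ->
  rcont g t.
Proof.
intros H; split; apply filterlim_locally; intros e; destruct (H e (cond_pos e)) as [d [Hd K]];
exists (mkposreal d Hd); intros u Hu; specialize (K u Hu).
- change (Rabs (Re (g u) - Re (g t)) < e). eapply Rle_lt_trans; [|exact K].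
  exact (re_le_Cmod (g u - g t)).
- change (Rabs (Im (g u) - Im (g t)) < e). eapply Rle_lt_trans; [|exact K].
  exact (Im_le_Cmod (g u - g t)).
Qed.

Lemma rcont_ccont (F : C -> C) (p : R -> C) (t : R) :
  ccont F (p t) -> rcont p t -> rcont (fun u => F (p u)) t.
Proof.
intros HF [Hx Hy]. apply rcont_eps. intros e He.
destruct (HF e He) as [d [Hd K]].
assert (Hd2 : 0 < d/2) by lra.
destruct (proj1 (filterlim_locally _ _) Hx (mkposreal _ Hd2)) as [d1 K1].
destruct (proj1 (filterlim_locally _ _) Hy (mkposreal _ Hd2)) as [d2 K2].
exists (Rmin d1 d2); split; [apply Rmin_pos; apply cond_pos|]. intros u Hu.
apply K. eapply Rle_lt_trans; [apply Cmod_le_Re_Im|].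
specialize (K1 u (Rlt_le_trans _ _ _ Hu (Rmin_l _ _))).
specialize (K2 u (Rlt_le_trans _ _ _ Hu (Rmin_r _ _))).
change (Rabs (Re (p u) - Re (p t)) < d/2) in K1.
change (Rabs (Im (p u) - Im (p t)) < d/2) in K2.
change (Rabs (Re (p u) - Re (p t)) + Rabs (Im (p u) - Im (p t)) < d)%R. lra.
Qed.

Definition cont_on (g : R -> C) (a b : R) : Prop := forall t, a <= t <= b -> rcont g t.

Lemma cont_on_sub (g : R -> C) (a b c d : R) : a <= c -> d <= b -> cont_on g a b -> cont_on g c d.
Proof. intros H1 H2 H t Ht. apply H; lra. Qed.

Lemma cont_on_ex_RInt (g : R -> C) (a b : R) : a <= b -> cont_on g a b ->
  ex_RInt (fun t => Re (g t)) a b /\ ex_RInt (fun t => Im (g t)) a b.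
Proof.
intros Hab H; split; apply (@ex_RInt_continuous R_CompleteNormedModule); intros t Ht;
rewrite Rmin_left, Rmax_right in Ht by assumption; now apply H.
Qed.

Lemma CInt_ext (f g : R -> C) (a b : R) : a <= b ->
  (forall t, a <= t <= b -> f t = g t) -> CInt f a b = CInt g a b.
Proof.
intros Hab E. unfold CInt; f_equal; apply (@RInt_ext R_CompleteNormedModule); intros t Ht;
rewrite Rmin_left, Rmax_right in Ht by assumption; rewrite E; auto; lra.
Qed.

Lemma CInt_plus (f g : R -> C) (a b : R) : a <= b -> cont_on f a b -> cont_on g a b ->
  CInt (fun t => f t + g t) a b = CInt f a b + CInt g a b.
Proof.
intros Hab Hf Hg. destruct (cont_on_ex_RInt f a b Hab Hf). destruct (cont_on_ex_RInt g a b Hab Hg).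
unfold CInt, Cplus; simpl; f_equal; now apply (@RInt_plus R_CompleteNormedModule).
Qed.

Lemma RInt_lin2 (f g : R -> R) (a b x y : R) : ex_RInt f a b -> ex_RInt g a b ->
  RInt (fun t => x * f t + y * g t)%R a b = (x * RInt f a b + y * RInt g a b)%R.
Proof.
intros Hf Hg.
rewrite (@RInt_plus R_CompleteNormedModule (fun t => scal x (f t)) (fun t => scal y (g t))).
- rewrite !(@RInt_scal R_CompleteNormedModule) by assumption. reflexivity.
- now apply @ex_RInt_scal.
- now apply @ex_RInt_scal.
Qed.

Lemma CInt_scal (c : C) (f : R -> C) (a b : R) : a <= b -> cont_on f a b ->
  CInt (fun t => c * f t) a b = c * CInt f a b.
Proof.
intros Hab Hf. destruct (cont_on_ex_RInt f a b Hab Hf).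
unfold CInt, Cmult; simpl; f_equal.
- rewrite <- (Ropp_involutive (snd c * _)), Ropp_mult_distr_l.
  unfold Rminus; rewrite Ropp_involutive. rewrite <- RInt_lin2 by assumption.
  apply (@RInt_ext R_CompleteNormedModule); intros t _. unfold Re, Im. simpl. ring.
- rewrite Rplus_comm. rewrite <- RInt_lin2 by assumption.
  apply (@RInt_ext R_CompleteNormedModule); intros t _. unfold Re, Im. simpl. ring.
Qed.

Lemma CInt_minus (f g : R -> C) (a b : R) : a <= b -> cont_on f a b -> cont_on g a b ->
  CInt (fun t => f t - g t) a b = CInt f a b - CInt g a b.
Proof.
intros Hab Hf Hg. destruct (cont_on_ex_RInt f a b Hab Hf). destruct (cont_on_ex_RInt g a b Hab Hg).
unfold CInt, Cminus, Cplus, Copp; simpl; f_equal; now apply (@RInt_minus R_CompleteNormedModule).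
Qed.

Lemma CInt_Chasles (f : R -> C) (a b c : R) : a <= b -> b <= c -> cont_on f a c ->
  CInt f a c = CInt f a b + CInt f b c.
Proof.
intros Hab Hbc Hf.
destruct (cont_on_ex_RInt f a b Hab (cont_on_sub _ a c a b (Rle_refl _) Hbc Hf)).
destruct (cont_on_ex_RInt f b c Hbc (cont_on_sub _ a c b c Hab (Rle_refl _) Hf)).
unfold CInt, Cplus; simpl; f_equal; symmetry; now apply (@RInt_Chasles R_CompleteNormedModule).
Qed.

Lemma CInt_const (c : C) (a b : R) : CInt (fun _ => c) a b = (b - a)%R * c.
Proof.
unfold CInt. rewrite !(@RInt_const R_CompleteNormedModule).
destruct c as [x y]; unfold Cmult, RtoC, Re, Im, scal; simpl. unfold mult; simpl. f_equal; ring.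
Qed.

(* The factor 2, absent from the sharp bound, comes from estimating the two components separately. *)
Lemma CInt_bound (f : R -> C) (a b M : R) : a <= b -> cont_on f a b ->
  (forall t, a <= t <= b -> Cmod (f t) <= M) -> (Cmod (CInt f a b) <= 2 * ((b - a) * M))%R.
Proof.
intros Hab Hf HM. destruct (cont_on_ex_RInt f a b Hab Hf).
eapply Rle_trans; [apply Cmod_le_Re_Im|]. unfold CInt; simpl.
assert (Rabs (RInt (fun t => Re (f t)) a b) <= (b - a) * M)%R.
{ apply abs_RInt_le_const; auto. intros t Ht. eapply Rle_trans; [apply re_le_Cmod|auto]. }
assert (Rabs (RInt (fun t => Im (f t)) a b) <= (b - a) * M)%R.
{ apply abs_RInt_le_const; auto. intros t Ht. eapply Rle_trans; [apply Im_le_Cmod|auto]. }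
lra.
Qed.

(** * Goursat's theorem for rectangles *)

(* The integral of [F] over the counterclockwise boundary of [[a, b] x [c, d]]. *)
Definition rect_int (F : C -> C) (a b c d : R) : C :=
  Ci * (CInt (fun t => F (b, t)) c d - CInt (fun t => F (a, t)) c d)
  + (CInt (fun s => F (s, c)) a b - CInt (fun s => F (s, d)) a b).

Definition on_rect (P : C -> Prop) (a b c d : R) : Prop :=
  forall x y, a <= x <= b -> c <= y <= d -> P (x, y).

Lemma rcont_re (y t : R) : rcont (fun s => (s, y)) t.
Proof. split; [apply continuous_id | apply continuous_const]. Qed.

Lemma rcont_im (x t : R) : rcont (fun s => (x, s)) t.
Proof. split; [apply continuous_const | apply continuous_id]. Qed.

Lemma cont_on_re (F : C -> C) (a b c d y : R) :
  on_rect (ccont F) a b c d -> c <= y <= d -> cont_on (fun s => F (s, y)) a b.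
Proof. intros H Hy t Ht. apply (rcont_ccont F (fun s => (s, y))); [now apply H | apply rcont_re]. Qed.

Lemma cont_on_im (F : C -> C) (a b c d x : R) :
  on_rect (ccont F) a b c d -> a <= x <= b -> cont_on (fun s => F (x, s)) c d.
Proof. intros H Hx t Ht. apply (rcont_ccont F (fun s => (x, s))); [now apply H | apply rcont_im]. Qed.

(** Each inner side is traversed twice, in opposite directions. *)
Lemma rect_int_quarter (F : C -> C) (a b c d m n : R) :
  a <= m <= b -> c <= n <= d -> on_rect (ccont F) a b c d ->
  rect_int F a b c d =
    rect_int F a m c n + rect_int F m b c n + rect_int F a m n d + rect_int F m b n d.
Proof.
intros Hm Hn H. unfold rect_int.
rewrite (CInt_Chasles (fun t => F (b, t)) c n d); try lra.
2: { apply (cont_on_im F a b c d); auto; lra. }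
rewrite (CInt_Chasles (fun t => F (a, t)) c n d); try lra.
2: { apply (cont_on_im F a b c d); auto; lra. }
rewrite (CInt_Chasles (fun t => F (t, c)) a m b); try lra.
2: { apply (cont_on_re F a b c d); auto; lra. }
rewrite (CInt_Chasles (fun t => F (t, d)) a m b); try lra.
2: { apply (cont_on_re F a b c d); auto; lra. }
ring.
Qed.

Lemma rect_int_plus (F G : C -> C) (a b c d : R) : a <= b -> c <= d ->
  on_rect (ccont F) a b c d -> on_rect (ccont G) a b c d ->
  rect_int (fun z => F z + G z) a b c d = rect_int F a b c d + rect_int G a b c d.
Proof.
intros Hab Hcd HF HG. unfold rect_int.
rewrite !CInt_plus; auto; try (eapply cont_on_im; eauto; lra); try (eapply cont_on_re; eauto; lra).
ring.
Qed.

Lemma RInt_id (a b : R) : RInt (fun t => t) a b = ((b * b - a * a) / 2)%R.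
Proof.
apply is_RInt_unique.
replace ((b * b - a * a) / 2)%R with (minus (b * b / 2) (a * a / 2))%R by (unfold minus, plus, opp; simpl; field).
apply (is_RInt_derive (fun t => t * t / 2)%R).
- intros x _. auto_derive; [trivial | field].
- intros x _. apply continuous_id.
Qed.

(** This disposes of the first-order part of [F] in [rect_int_local]; a direct computation of the
    four integrals suffices. *)
Lemma rect_int_affine (p q : C) (a b c d : R) : a <= b -> c <= d ->
  rect_int (fun z => p + q * z) a b c d = 0.
Proof.
intros Hab Hcd.
assert (H : on_rect (ccont (fun z : C => z)) a b c d) by (intros x y _ _; apply ccont_id).
assert (H1 : on_rect (ccont (fun z : C => q * z)) a b c d).
{ intros x y _ _. apply ccont_mult; [apply ccont_const | apply ccont_id]. }
assert (H0 : on_rect (ccont (fun z : C => p)) a b c d) by (intros x y _ _; apply ccont_const).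
rewrite rect_int_plus by assumption.
unfold rect_int. rewrite !CInt_const.
rewrite (CInt_scal q (fun t => (b, t))), (CInt_scal q (fun t => (a, t))),
  (CInt_scal q (fun s => (s, c))), (CInt_scal q (fun s => (s, d))); try assumption;
  try (intros t _; apply rcont_re); try (intros t _; apply rcont_im).
transitivity (q * (Ci * (CInt (fun t => (b, t)) c d - CInt (fun t => (a, t)) c d)
  + (CInt (fun s => (s, c)) a b - CInt (fun s => (s, d)) a b))); [ring|].
replace (Ci * _ + _) with (RtoC 0); [ring|].
unfold CInt, Re, Im; simpl. rewrite !(@RInt_const R_CompleteNormedModule), !RInt_id.
unfold Cminus, Cplus, Cmult, Copp, Ci, RtoC, scal; simpl. unfold mult; simpl.
f_equal; field.
Qed.

(** The perimeter is [2 * ((b - a) + (d - c))]; the other factor 2 is the one lost in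
    [CInt_bound]. *)
Lemma rect_int_bound (F : C -> C) (a b c d M : R) : a <= b -> c <= d ->
  on_rect (ccont F) a b c d -> on_rect (fun z => Cmod (F z) <= M) a b c d ->
  (Cmod (rect_int F a b c d) <= 4 * ((b - a) + (d - c)) * M)%R.
Proof.
intros Hab Hcd H HM. unfold rect_int.
assert (B1 := CInt_bound _ c d M Hcd (cont_on_im F a b c d b H ltac:(lra)) (fun t Ht => HM b t ltac:(lra) Ht)).
assert (B2 := CInt_bound _ c d M Hcd (cont_on_im F a b c d a H ltac:(lra)) (fun t Ht => HM a t ltac:(lra) Ht)).
assert (B3 := CInt_bound _ a b M Hab (cont_on_re F a b c d c H ltac:(lra)) (fun t Ht => HM t c Ht ltac:(lra))).
assert (B4 := CInt_bound _ a b M Hab (cont_on_re F a b c d d H ltac:(lra)) (fun t Ht => HM t d Ht ltac:(lra))).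
eapply Rle_trans; [apply Cmod_triangle|].
rewrite Cmod_mult, Cmod_Ci, Rmult_1_l.
eapply Rle_trans; [apply Rplus_le_compat; apply Cmod_triangle|].
rewrite !Cmod_opp. lra.
Qed.

Lemma Cmod_rect_dist (a b c d x y u v : R) :
  a <= x <= b -> c <= y <= d -> a <= u <= b -> c <= v <= d ->
  (Cmod ((x, y) - (u, v)) <= (b - a) + (d - c))%R.
Proof.
intros. eapply Rle_trans; [apply Cmod_le_Re_Im|].
apply Rplus_le_compat; apply Rabs_le; unfold Re, Im; simpl; lra.
Qed.

Lemma rect_int_local (F : C -> C) (x y : R) (D : C) : cder F (x, y) D ->
  forall e, 0 < e -> exists r, 0 < r /\ forall a b c d,
    a <= x <= b -> c <= y <= d -> (b - a) + (d - c) < r ->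
    on_rect (ccont F) a b c d ->
    (Cmod (rect_int F a b c d) <= e * ((b - a) + (d - c)) ^ 2)%R.
Proof.
intros [p [Hp [Ep E]]] e He.
(* With [s] half the perimeter, the remainder of [F] after its affine part is at most [e / 4 * s] on
   the rectangle, and [rect_int_bound] contributes [4 * s]. *)
destruct (Hp (e/4)%R) as [r [Hr K]]; [lra|].
exists r; split; [assumption|]. intros a b c d Hx Hy Hs HF.
set (A := fun z : C => (F (x, y) - D * (x, y)) + D * z).
assert (HA : on_rect (ccont A) a b c d).
{ intros u v _ _. apply ccont_plus; [apply ccont_const|]. apply ccont_mult; [apply ccont_const | apply ccont_id]. }
set (G := fun z : C => F z + - A z).
assert (HG : on_rect (ccont G) a b c d).
{ intros u v Hu Hv. apply ccont_plus; [now apply HF|]. apply ccont_opp; now apply HA. }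
assert (EJ : rect_int F a b c d = rect_int A a b c d + rect_int G a b c d).
{ rewrite <- rect_int_plus by (auto; lra). unfold rect_int, CInt.
  repeat (apply f_equal2 || apply f_equal); try reflexivity;
  apply (@RInt_ext R_CompleteNormedModule); intros t _; f_equal; unfold G; ring. }
rewrite EJ. unfold A at 1. rewrite rect_int_affine by lra. rewrite Cplus_0_l.
set (s := ((b - a) + (d - c))%R) in *.
replace (e * s ^ 2)%R with (4 * s * (e / 4 * s))%R by field.
apply rect_int_bound; [lra | lra | assumption|].
intros u v Hu Hv.
assert (Hd : Cmod ((u, v) - (x, y)) <= s) by now apply Cmod_rect_dist.
replace (G (u, v)) with ((p (u, v) - p (x, y)) * ((u, v) - (x, y))).
2: { unfold G, A. rewrite (E (u, v)), Ep. ring. }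
rewrite Cmod_mult. apply Rmult_le_compat; try apply Cmod_ge_0; [|assumption].
apply Rlt_le, K. lra.
Qed.

Record rect := mkrect { rl : R; rr : R; rb : R; rt : R }.

(** Half the perimeter: it bounds all distances inside the rectangle, and quartering halves it
    exactly. *)
Definition rect_size (S : rect) : R := ((rr S - rl S) + (rt S - rb S))%R.

Definition half_rect (S T : rect) : Prop :=
  rl S <= rl T /\ rr T <= rr S /\ rb S <= rb T /\ rt T <= rt S /\
  rl T <= rr T /\ rb T <= rt T /\ (rect_size T = rect_size S / 2)%R.

(** The threshold is quadratic in the size, so the thresholds of the four quarters add up to that of
    the whole, and a bad rectangle has a bad quarter. Near a point of differentiability,
    [rect_int_local] forbids small bad rectangles. *)
Definition bad_rect (F : C -> C) (k : R) (S : rect) : Prop :=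
  k * rect_size S ^ 2 < Cmod (rect_int F (rl S) (rr S) (rb S) (rt S)).

(** The quarter is found by testing the four candidates with [Rlt_dec]; if all tests fail, the
    triangle inequality contradicts badness of [S]. The existential is informative so that the
    nested sequence in [goursat_rect] can be defined by recursion. *)
Lemma bad_rect_half (F : C -> C) (k : R) (S : rect) :
  rl S <= rr S -> rb S <= rt S ->
  on_rect (ccont F) (rl S) (rr S) (rb S) (rt S) -> bad_rect F k S ->
  {T | half_rect S T /\ bad_rect F k T}.
Proof.
intros H1 H2 HF HB.
set (m := ((rl S + rr S) / 2)%R). set (n := ((rb S + rt S) / 2)%R).
assert (Hm : rl S <= m <= rr S) by (unfold m; lra).
assert (Hn : rb S <= n <= rt S) by (unfold n; lra).
assert (half : forall T, T = mkrect (rl S) m (rb S) n \/ T = mkrect m (rr S) (rb S) n \/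
  T = mkrect (rl S) m n (rt S) \/ T = mkrect m (rr S) n (rt S) -> half_rect S T).
{ intros T HT; unfold half_rect, rect_size;
  destruct HT as [->|[->|[->| ->]]]; simpl; unfold m, n in *; repeat split; lra. }
destruct (Rlt_dec (k * rect_size (mkrect (rl S) m (rb S) n) ^ 2) (Cmod (rect_int F (rl S) m (rb S) n))) as [B|G1].
{ exists (mkrect (rl S) m (rb S) n); split; [apply half; auto | exact B]. }
destruct (Rlt_dec (k * rect_size (mkrect m (rr S) (rb S) n) ^ 2) (Cmod (rect_int F m (rr S) (rb S) n))) as [B|G2].
{ exists (mkrect m (rr S) (rb S) n); split; [apply half; auto | exact B]. }
destruct (Rlt_dec (k * rect_size (mkrect (rl S) m n (rt S)) ^ 2) (Cmod (rect_int F (rl S) m n (rt S)))) as [B|G3].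
{ exists (mkrect (rl S) m n (rt S)); split; [apply half; auto | exact B]. }
destruct (Rlt_dec (k * rect_size (mkrect m (rr S) n (rt S)) ^ 2) (Cmod (rect_int F m (rr S) n (rt S)))) as [B|G4].
{ exists (mkrect m (rr S) n (rt S)); split; [apply half; auto | exact B]. }
exfalso. unfold bad_rect in HB.
rewrite (rect_int_quarter F _ _ _ _ m n Hm Hn HF) in HB.
assert (HS : forall T, half_rect S T -> (k * rect_size T ^ 2 = k * rect_size S ^ 2 / 4)%R).
{ intros T HT. destruct HT as [_ [_ [_ [_ [_ [_ ->]]]]]]. field. }
rewrite HS in G1, G2, G3, G4 by (apply half; auto).
pose proof (Cmod_triangle (rect_int F (rl S) m (rb S) n + rect_int F m (rr S) (rb S) n + rect_int F (rl S) m n (rt S)) (rect_int F m (rr S) n (rt S))).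
pose proof (Cmod_triangle (rect_int F (rl S) m (rb S) n + rect_int F m (rr S) (rb S) n) (rect_int F (rl S) m n (rt S))).
pose proof (Cmod_triangle (rect_int F (rl S) m (rb S) n) (rect_int F m (rr S) (rb S) n)).
lra.
Qed.

Lemma nested_point (l r : nat -> R) :
  (forall n, l n <= l (S n)) -> (forall n, r (S n) <= r n) -> (forall n, l n <= r n) ->
  exists x, forall n, l n <= x <= r n.
Proof.
intros Hl Hr H.
assert (ML : forall n k, l n <= l (n + k)%nat).
{ intros n k; induction k as [|k IH]; [rewrite Nat.add_0_r; lra|].
  rewrite Nat.add_succ_r. specialize (Hl (n + k)%nat); lra. }
assert (MR : forall n k, r (n + k)%nat <= r n).
{ intros n k; induction k as [|k IH]; [rewrite Nat.add_0_r; lra|].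
  rewrite Nat.add_succ_r. specialize (Hr (n + k)%nat); lra. }
assert (LR : forall n m, l n <= r m).
{ intros n m. specialize (ML n m); specialize (MR m n). rewrite (Nat.add_comm m n) in MR.
  specialize (H (n + m)%nat); lra. }
destruct (completeness (fun x => exists n, x = l n)) as [x [U L]].
- exists (r 0%nat). intros y [n ->]. apply LR.
- exists (l 0%nat). now exists 0%nat.
- exists x. intros n; split; [apply U; now exists n|]. apply L. intros y [m ->]. apply LR.
Qed.

Theorem goursat_rect (F : C -> C) (a b c d : R) : a <= b -> c <= d ->
  on_rect (fun z => exists D, cder F z D) a b c d -> rect_int F a b c d = 0.
Proof.
intros Hab Hcd HD.
assert (HC : on_rect (ccont F) a b c d).
{ intros x y Hx Hy. destruct (HD x y Hx Hy) as [D H]. now apply cder_ccont with D. }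
destruct (Ceq_dec (rect_int F a b c d) 0) as [|N]; [assumption|exfalso].
apply Cmod_gt_0 in N.
set (J := Cmod (rect_int F a b c d)) in *.
set (s := ((b - a) + (d - c))%R).
(* The summand 1 makes [k * s ^ 2 < J] strict, so the whole rectangle is bad, and keeps the
   denominator positive for a degenerate one. *)
set (k := (J / (s ^ 2 + 1))%R).
assert (Hs2 : (0 <= s ^ 2)%R) by apply pow2_ge_0.
assert (Hk : 0 < k) by (apply Rdiv_lt_0_compat; lra).
set (ok := fun S => a <= rl S /\ rr S <= b /\ c <= rb S /\ rt S <= d /\ rl S <= rr S /\ rb S <= rt S /\ bad_rect F k S).
assert (H0 : ok (mkrect a b c d)).
{ unfold ok, bad_rect, rect_size; simpl. repeat split; try lra. fold s J.
  replace J with (k * (s ^ 2 + 1))%R at 1 by (unfold k; field; lra). fold J. simpl in Hs2 |- *.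
  replace (Cmod (rect_int F a b c d)) with (k * (s ^ 2 + 1))%R by (unfold k, J; field; lra).
  simpl. lra. }
assert (step : forall S : {S | ok S}, {T : {T | ok T} | half_rect (proj1_sig S) (proj1_sig T)}).
{ intros [S HS]. unfold ok in HS.
  destruct (bad_rect_half F k S) as [T [HT BT]]; try tauto.
  - intros x y Hx Hy. apply HC; lra.
  - assert (HT' : ok T) by (unfold half_rect in HT; unfold ok; repeat split; try tauto; lra).
    now exists (exist _ T HT'). }
set (seq := fix seq n := match n with O => exist ok _ H0 | S n => proj1_sig (step (seq n)) end).
set (R_ := fun n => proj1_sig (seq n)).
assert (OK : forall n, ok (R_ n)) by (intros n; exact (proj2_sig (seq n))).
assert (HF : forall n, half_rect (R_ n) (R_ (S n))) by (intros n; exact (proj2_sig (step (seq n)))).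
destruct (nested_point (fun n => rl (R_ n)) (fun n => rr (R_ n))) as [x Hx].
1, 2: intros n; specialize (HF n); unfold half_rect in HF; tauto.
{ intros n; specialize (OK n); unfold ok in OK; tauto. }
destruct (nested_point (fun n => rb (R_ n)) (fun n => rt (R_ n))) as [y Hy].
1, 2: intros n; specialize (HF n); unfold half_rect in HF; tauto.
{ intros n; specialize (OK n); unfold ok in OK; tauto. }
destruct (HD x y) as [D Dxy]; [exact (Hx 0%nat) | exact (Hy 0%nat)|].
destruct (rect_int_local F x y D Dxy k Hk) as [r [Hr K]].
assert (SZ : forall n, (rect_size (R_ n) = s * (/ 2) ^ n)%R).
{ induction n as [|n IH].
  - unfold R_, rect_size, s; simpl; ring.
  - destruct (HF n) as [_ [_ [_ [_ [_ [_ ->]]]]]]. rewrite IH. simpl. field. }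
(* Some rectangle of the sequence is smaller than the radius [r] that [rect_int_local] gives at the
   common point [(x, y)]; [s + 1] avoids a division by zero. *)
destruct (pow_lt_1_zero (/ 2)%R) with (y := (r / (s + 1))%R) as [n Hn].
{ rewrite Rabs_pos_eq; lra. }
{ apply Rdiv_lt_0_compat; unfold s; lra. }
specialize (Hn n (le_n n)).
assert (P2 : 0 < (/ 2) ^ n) by (apply pow_lt; lra).
rewrite Rabs_pos_eq in Hn by lra.
assert (Hsm : rect_size (R_ n) < r).
{ rewrite SZ. apply Rlt_le_trans with ((s + 1) * (r / (s + 1)))%R.
  - assert (0 <= s) by (unfold s; lra).
    apply Rle_lt_trans with ((s + 1) * (/ 2) ^ n)%R; [nra|].
    apply Rmult_lt_compat_l; lra.
  - apply Req_le; field; unfold s; lra. }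
destruct (OK n) as [A1 [A2 [A3 [A4 [A5 [A6 A7]]]]]].
unfold bad_rect in A7. apply Rlt_not_le in A7. apply A7.
apply K; auto.
intros u v Hu Hv. apply HC; lra.
Qed.

(** * Integrals over circles *)

Definition circ (r t : R) : C := ((r * cos t)%R, (r * sin t)%R).

(** The integral is taken in the angle: on a circle about [0] one has [dz = Ci * z dt], so the
    contour integral of [g] is [Ci] times [circ_int] of [g z * z]. This accounts for the factor [w]
    in the kernel of [cauchy_formula], and makes [circ_int F r] equal to [2 * PI] times a mean
    value. *)
Definition circ_int (F : C -> C) (r : R) : C := CInt (fun t => F (circ r t)) 0 (2 * PI).

Definition differentiable_at (F : C -> C) (z : C) : Prop := exists D, cder F z D.

Lemma two_PI_pos : (0 <= 2 * PI)%R.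
Proof. pose proof PI_RGT_0; lra. Qed.

Lemma Cmod_circ (r t : R) : 0 <= r -> Cmod (circ r t) = r.
Proof.
intros Hr. unfold Cmod, circ; cbn [fst snd].
replace ((r * cos t) ^ 2 + (r * sin t) ^ 2)%R with (r * r * (Rsqr (sin t) + Rsqr (cos t)))%R
  by (unfold Rsqr; ring).
rewrite sin2_cos2, Rmult_1_r. now apply sqrt_square.
Qed.

Lemma circ_Cexp (s t : R) : circ (exp s) t = Cexp (s, t).
Proof. reflexivity. Qed.

Lemma rcont_circ (r t : R) : rcont (circ r) t.
Proof.
split; unfold circ, Re, Im; simpl; apply (@continuous_mult R_UniformSpace R_AbsRing);
  try apply continuous_const; apply (@ex_derive_continuous R_AbsRing R_NormedModule); auto_derive; trivial.
Qed.

Lemma cont_on_circ (F : C -> C) (r a b : R) : 0 <= r ->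
  (forall z, Cmod z = r -> ccont F z) -> cont_on (fun t => F (circ r t)) a b.
Proof.
intros Hr H t _. apply rcont_ccont; [|apply rcont_circ].
apply H. now apply Cmod_circ.
Qed.

(* Goursat's theorem for [F o Cexp] on a rectangle of height [2 PI], whose horizontal sides cancel
   by periodicity. *)
Lemma circ_int_annulus (F : C -> C) (r1 r2 : R) : 0 < r1 -> r1 <= r2 ->
  (forall z, r1 <= Cmod z <= r2 -> differentiable_at F z) -> circ_int F r1 = circ_int F r2.
Proof.
intros H1 H12 HF.
assert (L : ln r1 <= ln r2).
{ destruct H12 as [H12 | ->]; [left; now apply ln_increasing | right; reflexivity]. }
pose proof two_PI_pos as HP.
assert (G := goursat_rect (fun z => F (Cexp z)) (ln r1) (ln r2) 0 (2 * PI) L HP).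
assert (E : forall x, CInt (fun t => F (Cexp (x, t))) 0 (2 * PI) = circ_int F (exp x)) by reflexivity.
unfold rect_int in G. rewrite !E in G. rewrite !exp_ln in G by lra.
assert (P : CInt (fun s => F (Cexp (s, 0%R))) (ln r1) (ln r2) = CInt (fun s => F (Cexp (s, (2 * PI)%R))) (ln r1) (ln r2)).
{ apply CInt_ext; [assumption|]. intros s _. f_equal.
  unfold Cexp, Re, Im; simpl. now rewrite cos_0, sin_0, cos_2PI, sin_2PI. }
rewrite P in G.
assert (K : Ci * (circ_int F r2 - circ_int F r1) = 0).
{ rewrite <- G; [ring|]. intros x y Hx Hy.
  destruct (HF (Cexp (x, y))) as [D HD].
  { rewrite <- circ_Cexp, Cmod_circ by (apply Rlt_le, exp_pos).
    rewrite <- (exp_ln r1), <- (exp_ln r2) by lra.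
    split; [destruct (proj1 Hx) as [Q | ->] | destruct (proj2 Hx) as [Q | ->]]; try lra;
    left; now apply exp_increasing. }
  exists (D * Cexp (x, y)). apply (cder_comp Cexp F); [assumption | apply cder_Cexp]. }
destruct (Ceq_dec (circ_int F r2 - circ_int F r1) 0) as [Q|N].
- symmetry. now apply Ceq_minus.
- exfalso; revert K; apply Cmult_neq_0; [apply Ci_nz | assumption].
Qed.

Lemma circ_continuity_2d (F : C -> C) (r t : R) : ccont F (circ r t) ->
  continuity_2d_pt (fun r t => Re (F (circ r t))) r t /\
  continuity_2d_pt (fun r t => Im (F (circ r t))) r t.
Proof.
intros HF.
assert (Cr : continuity_2d_pt (fun r t => r * cos t)%R r t).
{ apply continuity_2d_pt_mult; [apply continuity_2d_pt_id1|].
  apply continuity_1d_2d_pt_comp; [apply continuity_cos | apply continuity_2d_pt_id2]. }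
assert (Ct : continuity_2d_pt (fun r t => r * sin t)%R r t).
{ apply continuity_2d_pt_mult; [apply continuity_2d_pt_id1|].
  apply continuity_1d_2d_pt_comp; [apply continuity_sin | apply continuity_2d_pt_id2]. }
assert (K : forall e : posreal, locally_2d (fun u v => Cmod (F (circ u v) - F (circ r t)) < e) r t).
{ intros e. destruct (HF e (cond_pos e)) as [d [Hd K]].
  assert (Hd2 : 0 < d/2) by lra.
  generalize (Cr (mkposreal _ Hd2)) (Ct (mkposreal _ Hd2)). intros A B.
  generalize (locally_2d_and _ _ _ _ A B). apply locally_2d_impl, locally_2d_forall.
  intros u v [Hu Hv]. simpl in Hu, Hv. apply K.
  eapply Rle_lt_trans; [apply Cmod_le_Re_Im|]. unfold circ, Re, Im; simpl. 
  unfold Rminus in Hu, Hv. lra. }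
split; intros e; generalize (K e); apply locally_2d_impl, locally_2d_forall; intros u v H;
  (eapply Rle_lt_trans; [|exact H]).
- exact (re_le_Cmod (F (circ u v) - F (circ r t))).
- exact (Im_le_Cmod (F (circ u v) - F (circ r t))).
Qed.

Lemma circ_int_cont (F : C -> C) (R0 r : R) : 0 <= r < R0 ->
  (forall z, Cmod z < R0 -> ccont F z) ->
  forall e, 0 < e -> exists d, 0 < d /\ forall s, 0 <= s < R0 -> Rabs (s - r) < d ->
    Cmod (circ_int F s - circ_int F r) < e.
Proof.
intros Hr HF e He. pose proof PI_RGT_0 as HP.
(* Each component varies by less than [e'], so [CInt_bound] yields [2 * (2 * PI) * (2 * e')], which
   is [e / 2]. *)
set (e' := (e / (16 * PI))%R).
assert (He' : 0 < e') by (apply Rdiv_lt_0_compat; lra).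
assert (HC : forall t, ccont F (circ r t)) by (intros t; apply HF; rewrite Cmod_circ; lra).
destruct (uniform_continuity_2d_1d' (fun r t => Re (F (circ r t))) 0 (2 * PI) r) with (eps := mkposreal _ He')
  as [d1 K1].
{ intros t _. apply circ_continuity_2d, HC. }
destruct (uniform_continuity_2d_1d' (fun r t => Im (F (circ r t))) 0 (2 * PI) r) with (eps := mkposreal _ He')
  as [d2 K2].
{ intros t _. apply circ_continuity_2d, HC. }
exists (Rmin d1 d2); split; [apply Rmin_pos; apply cond_pos|]. intros s Hs Hsr.
assert (S1 : Rabs (s - r) < d1) by (eapply Rlt_le_trans; [exact Hsr | apply Rmin_l]).
assert (S2 : Rabs (s - r) < d2) by (eapply Rlt_le_trans; [exact Hsr | apply Rmin_r]).
apply Rabs_def2 in S1. apply Rabs_def2 in S2.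
pose proof (cond_pos d1). pose proof (cond_pos d2).
assert (Q : forall u, 0 <= u < R0 -> cont_on (fun t => F (circ u t)) 0 (2 * PI)).
{ intros u Hu. apply cont_on_circ; [lra|]. intros z Hz; apply HF; lra. }
unfold circ_int. rewrite <- CInt_minus; [|apply two_PI_pos | apply Q; lra | apply Q; lra].
apply Rle_lt_trans with (2 * ((2 * PI - 0) * (2 * e')))%R.
- apply CInt_bound; [apply two_PI_pos| |].
  + intros t Ht. apply (Q s Hs) in Ht as A1. apply (Q r Hr) in Ht as A2.
    split; apply (@continuous_minus R_UniformSpace R_AbsRing R_NormedModule);
    first [apply A1 | apply A2].
  + intros t Ht. eapply Rle_trans; [apply Cmod_le_Re_Im|].
    specialize (K1 t r t s Ht ltac:(lra) Ht ltac:(lra)).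
    specialize (K2 t r t s Ht ltac:(lra) Ht ltac:(lra)).
    rewrite Rminus_diag, Rabs_R0 in K1, K2. 
    specialize (K1 ltac:(lra)). specialize (K2 ltac:(lra)). simpl in K1, K2.
    change (Rabs (Re (F (circ s t)) - Re (F (circ r t))) + Rabs (Im (F (circ s t)) - Im (F (circ r t))) <= 2 * e')%R. lra.
- apply Rle_lt_trans with (e / 2)%R; [|lra]. unfold e'. apply Req_le; field; lra.
Qed.

Lemma Ceq_eps (a b : C) : (forall e, 0 < e -> Cmod (a - b) < e) -> a = b.
Proof.
intros H. destruct (Ceq_dec a b) as [|N]; [assumption|exfalso].
apply (Rlt_irrefl (Cmod (a - b))), H. now apply Cmod_minus_gt_0.
Qed.

(** This extends a constant value from nearby radii to one that [circ_int_annulus] cannot reach: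
    radius [0], or a circle through a point where [F] may fail to be differentiable. *)
Lemma circ_int_limit (F : C -> C) (R0 r : R) (v : C) : 0 <= r < R0 ->
  (forall z, Cmod z < R0 -> ccont F z) ->
  (forall d, 0 < d -> exists s, 0 <= s < R0 /\ Rabs (s - r) < d /\ circ_int F s = v) ->
  circ_int F r = v.
Proof.
intros Hr HF H. apply Ceq_eps. intros e He.
destruct (circ_int_cont F R0 r Hr HF e He) as [d [Hd K]].
destruct (H d Hd) as [s [Hs [Hsr E]]]. rewrite <- E, Cmod_minus_sym. auto.
Qed.

Lemma circ_int_0 (F : C -> C) : circ_int F 0 = (2 * PI)%R * F 0.
Proof.
unfold circ_int. rewrite <- (Rminus_0_r (2 * PI)) at 2. rewrite <- CInt_const.
apply CInt_ext; [apply two_PI_pos|]. intros t _. f_equal.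
unfold circ, RtoC; f_equal; ring.
Qed.

(* Continuity of [circ_int F] in the radius lets the circle cross the exceptional point [p]. *)
Lemma circ_int_mean (F : C -> C) (R0 : R) (p : C) :
  (forall z, Cmod z < R0 -> ccont F z) ->
  (forall z, Cmod z < R0 -> z <> 0 -> z <> p -> differentiable_at F z) ->
  forall r, 0 <= r < R0 -> circ_int F r = (2 * PI)%R * F 0.
Proof.
intros HF HD.
assert (inner : forall r, 0 <= r < R0 -> r < Cmod p -> circ_int F r = (2 * PI)%R * F 0).
{ intros r Hr Hp. rewrite <- circ_int_0. destruct (Req_dec r 0) as [->|N]; [reflexivity|].
  symmetry. apply circ_int_limit with R0; [lra | assumption|]. intros d Hd.
  pose proof (Rmin_l (d/2) r). pose proof (Rmin_r (d/2) r).
  assert (0 < Rmin (d/2) r) by (apply Rmin_pos; lra).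
  exists (Rmin (d/2) r). repeat split; try lra.
  - rewrite Rminus_0_r, Rabs_pos_eq; lra.
  - apply circ_int_annulus; [lra | lra|]. intros z Hz. apply HD; [lra| |].
    + intros ->; rewrite Cmod_0 in Hz; lra.
    + intros ->; lra. }
assert (mid : Cmod p < R0 -> circ_int F (Cmod p) = (2 * PI)%R * F 0).
{ intros Hp. destruct (Req_dec (Cmod p) 0) as [E|N].
  { rewrite E. apply circ_int_0. }
  pose proof (Cmod_ge_0 p).
  apply circ_int_limit with R0; [lra | assumption|]. intros d Hd.
  pose proof (Rmin_l (d/2) (Cmod p)). pose proof (Rmin_r (d/2) (Cmod p)).
  assert (0 < Rmin (d/2) (Cmod p)) by (apply Rmin_pos; lra).
  exists (Cmod p - Rmin (d/2) (Cmod p))%R. repeat split; try lra.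
  - apply Rabs_def1; lra.
  - apply inner; lra. }
intros r Hr. destruct (Rtotal_order r (Cmod p)) as [L|[E|L]]; [now apply inner| |].
- rewrite E. apply mid; lra.
- rewrite <- (mid ltac:(lra)). symmetry. pose proof (Cmod_ge_0 p).
  apply circ_int_limit with R0; [lra | assumption|]. intros d Hd.
  pose proof (Rmin_l (d/2) (r - Cmod p)). pose proof (Rmin_r (d/2) (r - Cmod p)).
  assert (0 < Rmin (d/2) (r - Cmod p)) by (apply Rmin_pos; lra).
  exists (Cmod p + Rmin (d/2) (r - Cmod p))%R. repeat split; try lra.
  + apply Rabs_def1; lra.
  + apply circ_int_annulus; [lra | lra|]. intros z Hz. apply HD; [lra| |].
    * intros ->; rewrite Cmod_0 in Hz; lra.
    * intros ->; lra.
Qed.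

(** * Cauchy's formula *)

Lemma circle_neq (r : R) (z w : C) : Cmod w < r -> Cmod z = r -> z - w <> 0.
Proof.
intros Hw Hz E. apply Ceq_minus in E. subst; lra.
Qed.

Lemma Cmod_minus_ge (z w : C) : (Cmod z - Cmod w <= Cmod (z - w))%R.
Proof. pose proof (Cmod_le_minus z w). lra. Qed.

Lemma circ_int_ext (F G : C -> C) (r : R) : 0 <= r ->
  (forall z, Cmod z = r -> F z = G z) -> circ_int F r = circ_int G r.
Proof.
intros Hr H. apply CInt_ext; [apply two_PI_pos|]. intros t _. apply H. now apply Cmod_circ.
Qed.

Lemma circ_int_plus (F G : C -> C) (r : R) : 0 <= r ->
  (forall z, Cmod z = r -> ccont F z) -> (forall z, Cmod z = r -> ccont G z) ->
  circ_int (fun z => F z + G z) r = circ_int F r + circ_int G r.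
Proof.
intros Hr HF HG.
apply (CInt_plus (fun t => F (circ r t)) (fun t => G (circ r t)));
  [apply two_PI_pos | now apply cont_on_circ | now apply cont_on_circ].
Qed.

Lemma circ_int_minus (F G : C -> C) (r : R) : 0 <= r ->
  (forall z, Cmod z = r -> ccont F z) -> (forall z, Cmod z = r -> ccont G z) ->
  circ_int (fun z => F z - G z) r = circ_int F r - circ_int G r.
Proof.
intros Hr HF HG.
apply (CInt_minus (fun t => F (circ r t)) (fun t => G (circ r t)));
  [apply two_PI_pos | now apply cont_on_circ | now apply cont_on_circ].
Qed.

Lemma circ_int_scal (c : C) (F : C -> C) (r : R) : 0 <= r ->
  (forall z, Cmod z = r -> ccont F z) ->
  circ_int (fun z => c * F z) r = c * circ_int F r.
Proof.
intros Hr HF.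
apply (CInt_scal c (fun t => F (circ r t))); [apply two_PI_pos | now apply cont_on_circ].
Qed.

Lemma circ_int_bound (F : C -> C) (r M : R) : 0 <= r ->
  (forall z, Cmod z = r -> ccont F z) ->
  (forall t, 0 <= t <= 2 * PI -> Cmod (F (circ r t)) <= M) ->
  (Cmod (circ_int F r) <= 4 * PI * M)%R.
Proof.
intros Hr HF HM. replace (4 * PI * M)%R with (2 * ((2 * PI - 0) * M))%R by ring.
apply CInt_bound; [apply two_PI_pos | now apply cont_on_circ | assumption].
Qed.

Lemma circ_bounded (F : C -> C) (r : R) : 0 <= r ->
  (forall z, Cmod z = r -> ccont F z) ->
  exists B, 0 <= B /\ forall t, 0 <= t <= 2 * PI -> Cmod (F (circ r t)) <= B.
Proof.
intros Hr HF. pose proof (cont_on_circ F r 0 (2 * PI) Hr HF) as H.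
destruct (@bounded_continuity R_AbsRing R_NormedModule (fun t => Re (F (circ r t))) 0 (2 * PI)) as [A HA].
{ intros t Ht. apply (H t Ht). }
destruct (@bounded_continuity R_AbsRing R_NormedModule (fun t => Im (F (circ r t))) 0 (2 * PI)) as [B HB].
{ intros t Ht. apply (H t Ht). }
assert (K : forall t, 0 <= t <= 2 * PI -> Cmod (F (circ r t)) <= A + B).
{ intros t Ht. eapply Rle_trans; [apply Cmod_le_Re_Im|].
  apply Rplus_le_compat; apply Rlt_le; [exact (HA t Ht) | exact (HB t Ht)]. }
exists (A + B)%R; split; [|assumption].
eapply Rle_trans; [apply Cmod_ge_0 | apply (K 0%R)]. pose proof two_PI_pos; lra.
Qed.

(** The integral does not depend on the radius beyond [Cmod z], and [w / (w - z) = 1 + z / (w - z)],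
    whose second term dies out on large circles. *)
Lemma circ_int_kernel (z : C) (r : R) : Cmod z < r ->
  circ_int (fun w => w / (w - z)) r = (2 * PI)%R.
Proof.
intros Hz. pose proof (Cmod_ge_0 z) as Pz. pose proof PI_RGT_0 as HP.
apply Ceq_eps. intros e He.
(* Chosen so that [4 * PI * Cmod z / (s - Cmod z)], the bound for the integral of [z / (w - z)], is
   less than [e]. *)
set (s := (r + 4 * PI * (Cmod z + 1) / e + 1)%R).
assert (Q : 0 < 4 * PI * (Cmod z + 1) / e).
{ apply Rdiv_lt_0_compat; [|assumption]. apply Rmult_lt_0_compat; lra. }
assert (Hs : r <= s) by (unfold s; lra).
rewrite (circ_int_annulus _ r s); [ | lra | assumption |].
2: { intros w Hw. assert (N : w - z <> 0) by (apply (circle_neq (Cmod w)); lra).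
  eexists. apply (cder_div (fun w => w) (fun w => w - z)); [assumption | apply cder_id|].
  apply cder_minus; [apply cder_id | apply cder_const]. }
assert (N : forall w, Cmod w = s -> w - z <> 0).
{ intros w Hw. apply (circle_neq s); [unfold s in *; lra | assumption]. }
assert (E : circ_int (fun _ => 1) s = (2 * PI)%R).
{ unfold circ_int. rewrite CInt_const, Cmult_1_r, Rminus_0_r. reflexivity. }
rewrite <- E, <- circ_int_minus.
- rewrite (circ_int_ext _ (fun w => z / (w - z))).
  + eapply Rle_lt_trans; [apply circ_int_bound with (M := (Cmod z / (s - Cmod z))%R)|].
    * lra.
    * intros w Hw. apply ccont_div; [now apply N | apply ccont_const|].
      apply ccont_minus; [apply ccont_id | apply ccont_const].
    * intros t _. assert (Hc : Cmod (circ s t) = s) by (apply Cmod_circ; lra).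
      rewrite Cmod_div by now apply N.
      apply Rmult_le_compat_l; [assumption|]. apply Rinv_le_contravar; [lra|].
      rewrite <- Hc at 1. apply Cmod_minus_ge.
    * apply Rmult_lt_reg_r with (s - Cmod z)%R; [lra|].
      replace (4 * PI * (Cmod z / (s - Cmod z)) * (s - Cmod z))%R with (4 * PI * Cmod z)%R by (field; lra).
      apply Rlt_le_trans with (e * (4 * PI * (Cmod z + 1) / e))%R.
      { replace (e * (4 * PI * (Cmod z + 1) / e))%R with (4 * PI * (Cmod z + 1))%R by (field; lra). nra. }
      apply Rmult_le_compat_l; unfold s; lra.
  + lra.
  + intros w Hw. field. now apply N.
- lra.
- intros w Hw. apply ccont_div; [now apply N | apply ccont_id|].
  apply ccont_minus; [apply ccont_id | apply ccont_const].
- intros w _. apply ccont_const.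
Qed.

(** The function [w * ((f w - f z) / (w - z))], continued to [z], vanishes at [0], so its mean over
    every circle is [0]; expanding that mean gives the formula. The factor [w] also settles the case
    [z = 0], where the function is [f w - f 0] and continuity of [f] is enough. *)
Theorem cauchy_formula (f : C -> C) (R0 r : R) (z : C) :
  (forall w, Cmod w < R0 -> ccont f w) ->
  (forall w, Cmod w < R0 -> w <> 0 -> differentiable_at f w) ->
  Cmod z < r -> r < R0 ->
  circ_int (fun w => f w * w / (w - z)) r = (2 * PI)%R * f z.
Proof.
intros Hf Hd Hz Hr. pose proof (Cmod_ge_0 z) as Pz.
(* For [z <> 0], [D] is the derivative at [z]; for [z = 0] it is a dummy value, multiplied by
   [w = 0] in [F]. *)
assert (HD : exists D, z = 0 \/ cder f z D).
{ destruct (Ceq_dec z 0) as [E|N]; [exists 0; now left|].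
  destruct (Hd z ltac:(lra) N) as [D HD]. exists D; now right. }
destruct HD as [D HD].
set (F := fun w => w * (if Ceq_dec w z then D else (f w - f z) / (w - z))).
assert (EF : forall w, w <> z -> F w = w * ((f w - f z) / (w - z))).
{ intros w N. unfold F. destruct (Ceq_dec w z); [contradiction | reflexivity]. }
assert (E0 : F 0 = 0) by (unfold F; ring).
assert (N0 : forall w u, Cmod (u - w) < Cmod (w - z) -> u <> z).
{ intros w u Hu ->. rewrite Cmod_minus_sym in Hu; lra. }
assert (CF : forall w, Cmod w < R0 -> ccont F w).
{ intros w Hw. destruct (Ceq_dec w z) as [->|N].
  - destruct HD as [->|HD].
    + apply (ccont_ext_loc (fun w => f w - f 0) _ _ 1); [lra | |].
      * intros w _. destruct (Ceq_dec w 0) as [->|N]; [rewrite E0; ring|].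
        rewrite EF by assumption. field. now replace (w - 0) with w by ring.
      * apply ccont_minus; [now apply Hf | apply ccont_const].
    + apply ccont_mult; [apply ccont_id|]. now apply cder_slope.
  - apply (ccont_ext_loc (fun w => w * ((f w - f z) / (w - z))) _ _ (Cmod (w - z))).
    + now apply Cmod_minus_gt_0.
    + intros u Hu. rewrite EF; [reflexivity|]. now apply (N0 w).
    + apply ccont_mult; [apply ccont_id|]. apply ccont_div; [now apply Cminus_eq_contra| |].
      * apply ccont_minus; [now apply Hf | apply ccont_const].
      * apply ccont_minus; [apply ccont_id | apply ccont_const]. }
assert (DF : forall w, Cmod w < R0 -> w <> 0 -> w <> z -> differentiable_at F w).
{ intros w Hw Nw N. destruct (Hd w Hw Nw) as [D' HD']. eexists.
  apply (cder_ext_loc (fun w => w * ((f w - f z) / (w - z))) _ _ _ (Cmod (w - z))).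
  - now apply Cmod_minus_gt_0.
  - intros u Hu. rewrite EF; [reflexivity|]. now apply (N0 w).
  - apply cder_mult; [apply cder_id|]. apply (cder_div (fun w => f w - f z) (fun w => w - z)).
    + now apply Cminus_eq_contra.
    + apply cder_minus; [exact HD' | apply cder_const].
    + apply cder_minus; [apply cder_id | apply cder_const]. }
assert (M := circ_int_mean F R0 z CF DF r ltac:(lra)). rewrite E0, Cmult_0_r in M.
assert (Nr : forall w, Cmod w = r -> w - z <> 0) by (intros w Hw; now apply (circle_neq r)).
assert (CK : forall w, Cmod w = r -> ccont (fun w => w / (w - z)) w).
{ intros w Hw. apply ccont_div; [now apply Nr | apply ccont_id|].
  apply ccont_minus; [apply ccont_id | apply ccont_const]. }
rewrite (circ_int_ext F (fun w => f w * w / (w - z) - f z * (w / (w - z)))) in M.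
- rewrite circ_int_minus, circ_int_scal, circ_int_kernel in M; try assumption; try lra.
  + apply Ceq_minus. rewrite <- M. ring.
  + intros w Hw. apply ccont_div; [now apply Nr | |].
    * apply ccont_mult; [apply Hf; lra | apply ccont_id].
    * apply ccont_minus; [apply ccont_id | apply ccont_const].
  + intros w Hw. apply ccont_mult; [apply ccont_const | now apply CK].
- lra.
- intros w Hw. rewrite EF.
  + field. now apply Nr.
  + intros E. apply (Nr w Hw). rewrite E; ring.
Qed.

Lemma cder_of_quadratic (f : C -> C) (z d : C) (r K : R) : 0 < r -> 0 <= K ->
  (forall w, Cmod (w - z) < r -> (Cmod (f w - f z - d * (w - z)) <= K * Cmod (w - z) ^ 2)%R) ->
  cder f z d.
Proof.
intros Hr HK H. apply cder_of_bound. intros e He.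
exists (Rmin r (e / (K + 1)))%R. split.
{ apply Rmin_pos; [assumption|]. apply Rdiv_lt_0_compat; lra. }
intros w Hw. pose proof (Rmin_l r (e / (K + 1))). pose proof (Rmin_r r (e / (K + 1))).
eapply Rle_trans; [apply H; lra|]. simpl. rewrite Rmult_1_r, <- Rmult_assoc.
pose proof (Cmod_ge_0 (w - z)).
apply Rmult_le_compat_r; [assumption|].
apply Rle_trans with ((K + 1) * (e / (K + 1)))%R; [|apply Req_le; field; lra].
apply Rmult_le_compat; lra.
Qed.

(** Differentiation under the integral sign from a remainder that is quadratic uniformly on the
    circle. The Cauchy kernels are explicit enough for such a bound. *)
Lemma circ_int_param_cder (K K' : C -> C -> C) (r d M : R) (z : C) : 0 <= r -> 0 < d -> 0 <= M ->
  (forall w u, Cmod (w - z) < d -> Cmod u = r -> ccont (K w) u) ->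
  (forall u, Cmod u = r -> ccont (K' z) u) ->
  (forall w t, Cmod (w - z) < d -> 0 <= t <= 2 * PI ->
     (Cmod (K w (circ r t) - K z (circ r t) - (w - z) * K' z (circ r t)) <= M * Cmod (w - z) ^ 2)%R) ->
  cder (fun w => circ_int (K w) r) z (circ_int (K' z) r).
Proof.
intros Hr Hd HM HK HK' H. pose proof PI_RGT_0.
assert (Hz : Cmod (z - z) < d) by now rewrite Cmod_minus_self.
apply cder_of_quadratic with d (4 * PI * M)%R; [assumption | |].
{ apply Rmult_le_pos; lra. }
intros w Hw.
assert (C2 : forall u, Cmod u = r -> ccont (fun u => (w - z) * K' z u) u).
{ intros u Hu. apply ccont_mult; [apply ccont_const | now apply HK']. }
assert (C1 : forall u, Cmod u = r -> ccont (fun u => K w u - K z u) u).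
{ intros u Hu. apply (ccont_minus (K w) (K z)); now apply HK. }
rewrite Cmult_comm, <- circ_int_scal, <- (circ_int_minus (K w) (K z)) by auto.
rewrite <- (circ_int_minus (fun u => K w u - K z u)) by auto.
rewrite Rmult_assoc. apply circ_int_bound; [assumption | |].
- intros u Hu. apply (ccont_minus (fun u => K w u - K z u)); auto.
- intros t Ht. now apply H.
Qed.

Lemma cauchy_kernel_bounds (r : R) (z w u : C) : Cmod z < r ->
  Cmod (w - z) < (r - Cmod z) / 2 -> Cmod u = r ->
  ((r - Cmod z) <= Cmod (u - z) /\ (r - Cmod z) / 2 <= Cmod (u - w))%R /\
  u - z <> 0 /\ u - w <> 0.
Proof.
intros Hz Hw Hu.
assert (A : (r - Cmod z <= Cmod (u - z))%R) by (rewrite <- Hu; apply Cmod_minus_ge).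
assert (B : ((r - Cmod z) / 2 <= Cmod (u - w))%R).
{ pose proof (Cmod_minus_triangle u w z). lra. }
repeat split; try assumption; apply Cmod_gt_0; lra.
Qed.

Lemma Cmod_inv_le (z : C) (m : R) : 0 < m -> m <= Cmod z -> (Cmod (/ z) <= / m)%R.
Proof.
intros Hm Hz. rewrite Cmod_inv by (apply Cmod_gt_0; lra). now apply Rinv_le_contravar.
Qed.

Lemma cauchy_integral_cder1 (g : C -> C) (r : R) (z : C) :
  (forall u, Cmod u = r -> ccont g u) -> Cmod z < r ->
  cder (fun w => circ_int (fun u => g u / (u - w)) r) z
    (circ_int (fun u => g u / ((u - z) * (u - z))) r).
Proof.
intros Hg Hz. pose proof (Cmod_ge_0 z).
destruct (circ_bounded g r) as [B [HB KB]]; [lra | assumption |].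
set (d := (r - Cmod z)%R). assert (Hd : 0 < d) by (unfold d; lra).
(* The remainder is exactly [g u * (w - z) ^ 2 / ((u - w) * (u - z) ^ 2)]. On the circle [g] is at
   most [B], [u - z] at least [d], and [u - w] at least [d / 2]. *)
apply (circ_int_param_cder (fun w u => g u / (u - w)) (fun w u => g u / ((u - w) * (u - w))) r (d/2)
  (B * (/ (d/2) * / d * / d))).
- lra.
- lra.
- assert (0 < /d) by now apply Rinv_0_lt_compat. assert (0 < / (d/2)) by (apply Rinv_0_lt_compat; lra).
  apply Rmult_le_pos; [assumption|]. repeat apply Rmult_le_pos; lra.
- intros w u Hw Hu. destruct (cauchy_kernel_bounds r z w u Hz Hw Hu) as [_ [_ N]].
  apply ccont_div; [assumption | now apply Hg|]. apply ccont_minus; [apply ccont_id | apply ccont_const].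
- intros u Hu. assert (N : u - z <> 0) by now apply (circle_neq r).
  apply ccont_div; [now apply Cmult_neq_0 | now apply Hg|].
  apply ccont_mult; (apply ccont_minus; [apply ccont_id | apply ccont_const]).
- intros w t Hw Ht. assert (Hu := Cmod_circ r t ltac:(lra)). specialize (KB t Ht).
  set (u := circ r t) in *.
  destruct (cauchy_kernel_bounds r z w u Hz Hw Hu) as [[B1 B2] [N1 N2]]. fold d in B1, B2.
  replace (g u / (u - w) - g u / (u - z) - (w - z) * (g u / ((u - z) * (u - z))))
    with ((g u * (/ (u - w) * / (u - z) * / (u - z))) * (w - z) ^ 2) by (field; auto).
  rewrite !Cmod_mult. rewrite Cmod_pow. apply Rmult_le_compat_r; [apply pow2_ge_0|].
  repeat (apply Rmult_le_compat; repeat apply Rmult_le_pos; try apply Cmod_ge_0);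
  try assumption; apply Cmod_inv_le; lra.
Qed.

Lemma cauchy_integral_cder2 (g : C -> C) (r : R) (z : C) :
  (forall u, Cmod u = r -> ccont g u) -> Cmod z < r ->
  cder (fun w => circ_int (fun u => g u / ((u - w) * (u - w))) r) z
    (circ_int (fun u => 2 * g u / ((u - z) * (u - z) * (u - z))) r).
Proof.
intros Hg Hz. pose proof (Cmod_ge_0 z).
destruct (circ_bounded g r) as [B [HB KB]]; [lra | assumption |].
set (d := (r - Cmod z)%R). assert (Hd : 0 < d) by (unfold d; lra).
apply (circ_int_param_cder (fun w u => g u / ((u - w) * (u - w)))
  (fun w u => 2 * g u / ((u - w) * (u - w) * (u - w))) r (d/2)
  (B * (/ (d/2) * / (d/2) * (/ d * / d * / d) * (8 * r)))).
- lra.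
- lra.
- assert (0 < /d) by now apply Rinv_0_lt_compat. assert (0 < / (d/2)) by (apply Rinv_0_lt_compat; lra).
  apply Rmult_le_pos; [assumption|]. repeat apply Rmult_le_pos; lra.
- intros w u Hw Hu. destruct (cauchy_kernel_bounds r z w u Hz Hw Hu) as [_ [_ N]].
  apply ccont_div; [now apply Cmult_neq_0 | now apply Hg|].
  apply ccont_mult; (apply ccont_minus; [apply ccont_id | apply ccont_const]).
- intros u Hu. assert (N : u - z <> 0) by now apply (circle_neq r).
  apply ccont_div; [repeat apply Cmult_neq_0; assumption | apply ccont_mult; [apply ccont_const | now apply Hg]|].
  repeat apply ccont_mult; (apply ccont_minus; [apply ccont_id | apply ccont_const]).
- intros w t Hw Ht. assert (Hu := Cmod_circ r t ltac:(lra)). specialize (KB t Ht).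
  set (u := circ r t) in *.
  destruct (cauchy_kernel_bounds r z w u Hz Hw Hu) as [[B1 B2] [N1 N2]]. fold d in B1, B2.
  (* With [a = u - z] and [h = w - z], this is [1/(a-h)^2 - 1/a^2 - 2h/a^3 = h^2 (3a - 2h) /
     ((a-h)^2 a^3)]. *)
  replace (g u / ((u - w) * (u - w)) - g u / ((u - z) * (u - z)) - (w - z) * (2 * g u / ((u - z) * (u - z) * (u - z))))
    with ((g u * (/ (u - w) * / (u - w) * (/ (u - z) * / (u - z) * / (u - z)) * (3 * (u - z) - 2 * (w - z)))) * (w - z) ^ 2)
    by (field; auto).
  rewrite !Cmod_mult. rewrite Cmod_pow. apply Rmult_le_compat_r; [apply pow2_ge_0|].
  (* Here [Cmod (u - z)] is less than [2 * r] and [Cmod (w - z)] less than [r / 2], so [8 * r] is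
     ample. *)
  assert (Q : (Cmod (3 * (u - z) - 2 * (w - z)) <= 8 * r)%R).
  { unfold Cminus at 1. eapply Rle_trans; [apply Cmod_triangle|].
    rewrite Cmod_opp, !Cmod_mult, !Cmod_R, !Rabs_pos_eq by lra.
    assert (Cmod (u - z) <= r + Cmod z).
    { rewrite <- Hu. unfold Cminus. eapply Rle_trans; [apply Cmod_triangle|]. rewrite Cmod_opp; lra. }
    unfold d in *. lra. }
  repeat (apply Rmult_le_compat; repeat apply Rmult_le_pos; try apply Cmod_ge_0);
  try assumption; apply Cmod_inv_le; lra.
Qed.

Lemma RtoC_neq_0 (x : R) : x <> 0%R -> RtoC x <> 0.
Proof. intros H E; apply H. now apply RtoC_inj. Qed.

Lemma two_PI_neq_0 : RtoC (2 * PI) <> 0.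
Proof. apply RtoC_neq_0. pose proof PI_RGT_0; lra. Qed.

(** After translation to centre [0], Cauchy's formula on one fixed circle of radius [s] represents
    [f] in the whole smaller disc by an integral whose kernel can be differentiated twice. The
    inequality [s < r] leaves that circle inside the disc where [f] is differentiable. *)
Theorem derivative_differentiable (f : C -> C) (z0 : C) (r : R) :
  (forall w, Cmod (w - z0) < r -> differentiable_at f w) ->
  forall s, s < r -> exists f', forall w, Cmod (w - z0) < s -> cder f w (f' w) /\ differentiable_at f' w.
Proof.
intros Hf s Hs.
set (h := fun u => f (z0 + u)).
assert (Hh : forall w, Cmod w < r -> differentiable_at h w).
{ intros w Hw. destruct (Hf (z0 + w)) as [D HD].
  { now replace (z0 + w - z0) with w by ring. }
  exists (D * (0 + 1)). apply (cder_comp (fun u => z0 + u) f); [exact HD|].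
  apply cder_plus; [apply cder_const | apply cder_id]. }
assert (Ch : forall w, Cmod w < r -> ccont h w).
{ intros w Hw. destruct (Hh w Hw) as [D HD]. now apply cder_ccont with D. }
set (c := / RtoC (2 * PI)).
assert (Cg : forall u, Cmod u = s -> ccont (fun u => h u * u) u).
{ intros u Hu. apply ccont_mult; [apply Ch; lra | apply ccont_id]. }
assert (Eh : forall w, Cmod w < s -> h w = c * circ_int (fun u => h u * u / (u - w)) s).
{ intros w Hw. rewrite (cauchy_formula h r s w); auto.
  unfold c. rewrite Cmult_assoc, Cinv_l, Cmult_1_l; [reflexivity | apply two_PI_neq_0]. }
assert (Hc : forall F w D, cder F (w - z0) D -> cder (fun v => c * F (v - z0)) w (c * D)).
{ intros F w D HF. apply (cder_eq _ _ (0 * F (w - z0) + c * (D * (1 - 0)))); [ring|].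
  apply (cder_mult (fun _ => c) (fun v => F (v - z0))); [apply cder_const|].
  apply (cder_comp (fun v => v - z0) F); [assumption|].
  apply cder_minus; [apply cder_id | apply cder_const]. }
exists (fun v => c * circ_int (fun u => h u * u / ((u - (v - z0)) * (u - (v - z0)))) s).
intros w Hw. split.
- apply (cder_ext_loc (fun v => c * circ_int (fun u => h u * u / (u - (v - z0))) s) _ _ _ (s - Cmod (w - z0))).
  + lra.
  + intros v Hv. rewrite <- Eh.
    * unfold h. f_equal; ring.
    * pose proof (Cmod_minus_triangle v w z0); lra.
  + apply (Hc (fun x => circ_int (fun u => h u * u / (u - x)) s)).
    now apply cauchy_integral_cder1.
- eexists. apply (Hc (fun x => circ_int (fun u => h u * u / ((u - x) * (u - x))) s)).
  now apply cauchy_integral_cder2.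
Qed.

(** * Taylor series *)

Lemma ccont_pow (f : C -> C) (n : nat) (z : C) : ccont f z -> ccont (fun w => f w ^ n) z.
Proof.
intros Hf. induction n as [|n IH]; [apply (ccont_const 1)|].
apply (ccont_mult f (fun w => f w ^ n)); assumption.
Qed.

Lemma differentiable_mult (f g : C -> C) (z : C) :
  differentiable_at f z -> differentiable_at g z -> differentiable_at (fun w => f w * g w) z.
Proof. intros [a Ha] [b Hb]. eexists. apply cder_mult; eassumption. Qed.

Lemma differentiable_pow (f : C -> C) (n : nat) (z : C) :
  differentiable_at f z -> differentiable_at (fun w => f w ^ n) z.
Proof.
intros Hf. induction n as [|n IH].
- exists 0. apply (cder_const 1).
- now apply (differentiable_mult f (fun w => f w ^ n)).
Qed.

Lemma is_series_of_remainder (a : nat -> C) (l : C) :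
  (forall e, 0 < e -> exists N, forall n, (N <= n)%nat ->
     Cmod (sum_n (a : nat -> C_AbelianMonoid) n - l) < e) ->
  @is_series C_AbsRing C_NormedModule a l.
Proof.
intros H. apply filterlim_locally. intros e.
destruct (H e (cond_pos e)) as [N K]. exists N. intros n Hn.
apply C_NormedModule_mixin_compat1. exact (K n Hn).
Qed.

(** Cauchy's formula with the kernel expanded as a geometric series in [z / u]. The value of [c 0]
    is recorded because it becomes the leading coefficient of the Laurent expansion. *)
Theorem taylor_series (f : C -> C) (R0 : R) : 0 < R0 ->
  (forall w, Cmod w < R0 -> ccont f w) ->
  (forall w, Cmod w < R0 -> w <> 0 -> differentiable_at f w) ->
  exists c : nat -> C, c 0%nat = f 0 /\ forall z, Cmod z < R0 ->
    @is_series C_AbsRing C_NormedModule (fun n => c n * z ^ n) (f z).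
Proof.
intros HR Hf Hd. pose proof PI_RGT_0 as HP.
set (k := / RtoC (2 * PI)).
set (a := fun r n => k * circ_int (fun u => f u * (/ u) ^ n) r).
assert (Hk : forall x, k * (RtoC (2 * PI) * x) = x).
{ intros x. unfold k. rewrite Cmult_assoc, Cinv_l, Cmult_1_l; [reflexivity | apply two_PI_neq_0]. }
assert (Ha : forall r s n, 0 < r -> r < R0 -> 0 < s -> s < R0 -> a r n = a s n).
{ assert (W : forall r s n, 0 < r -> r <= s -> s < R0 -> a r n = a s n).
  { intros r s n Hr Hrs Hs. unfold a. f_equal. apply circ_int_annulus; [assumption | assumption |].
    intros z Hz. assert (z <> 0) by (intros ->; rewrite Cmod_0 in Hz; lra).
    apply differentiable_mult; [apply Hd; [lra | assumption]|]. apply differentiable_pow.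
    eexists. now apply cder_inv. }
  intros r s n ? ? ? ?. destruct (Rle_dec r s); [apply W; lra|]. symmetry; apply W; lra. }
(* By [Ha] the coefficients do not depend on the radius, so they may be fixed at [R0 / 2] although
   the expansion at [z] is derived on a circle of radius larger than [Cmod z]. *)
exists (a (R0 / 2)%R). split.
{ unfold a. rewrite (circ_int_ext _ f).
  - rewrite (circ_int_mean f R0 0); auto; lra.
  - lra.
  - intros z _. simpl. ring. }
intros z Hz. pose proof (Cmod_ge_0 z) as Pz.
set (r := ((Cmod z + R0) / 2)%R).
assert (Hr : Cmod z < r) by (unfold r; lra).
assert (Hr' : r < R0) by (unfold r; lra).
assert (N0 : forall u, Cmod u = r -> u <> 0) by (intros u Hu ->; rewrite Cmod_0 in Hu; lra).
assert (Nz : forall u, Cmod u = r -> u - z <> 0) by (intros u Hu; now apply (circle_neq r)).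
assert (Cp : forall n u, Cmod u = r -> ccont (fun u => f u * (z * / u) ^ n) u).
{ intros n u Hu. apply (ccont_mult f); [apply Hf; lra|].
  apply ccont_pow, ccont_div; [now apply N0 | apply ccont_const | apply ccont_id]. }
assert (Cq : forall u, Cmod u = r -> ccont (fun u => u / (u - z)) u).
{ intros u Hu. apply ccont_div; [now apply Nz | apply ccont_id|].
  apply ccont_minus; [apply ccont_id | apply ccont_const]. }
(* [G n] is the tail of the geometric series from exponent [n] on:
   [u / (u - z) = 1 + z / u * (u / (u - z))] splits off one term in [step]. *)
set (G := fun n u => f u * (z * / u) ^ n * (u / (u - z))).
assert (CG : forall n u, Cmod u = r -> ccont (G n) u).
{ intros n u Hu. apply ccont_mult; [now apply Cp | now apply Cq]. }
assert (term : forall n, a (R0 / 2)%R n * z ^ n = k * circ_int (fun u => f u * (z * / u) ^ n) r).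
{ intros n. rewrite (Ha _ r n) by lra. unfold a.
  rewrite <- Cmult_assoc, (Cmult_comm _ (z ^ n)), <- circ_int_scal.
  - f_equal. apply circ_int_ext; [lra|]. intros u _. rewrite Cpow_mult_l. ring.
  - lra.
  - intros u Hu. apply (ccont_mult f); [apply Hf; lra|]. now apply ccont_pow, ccont_inv, N0. }
assert (step : forall n, k * circ_int (G n) r = a (R0 / 2)%R n * z ^ n + k * circ_int (G (S n)) r).
{ intros n. rewrite term, <- Cmult_plus_distr_l. f_equal.
  rewrite <- circ_int_plus; [|lra | now apply Cp | now apply CG].
  apply circ_int_ext; [lra|]. intros u Hu. unfold G. rewrite Cpow_S. field.
  split; [now apply Nz | now apply N0]. }
assert (rem : forall n, f z = sum_n ((fun n => a (R0 / 2)%R n * z ^ n) : nat -> C_AbelianMonoid) n + k * circ_int (G (S n)) r).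
{ induction n as [|n IH].
  - rewrite sum_O, <- step. rewrite (circ_int_ext _ (fun u => f u * u / (u - z))).
    + rewrite (cauchy_formula f R0 r z); auto.
    + lra.
    + intros u Hu. unfold G. rewrite <- (Cmult_1_r (f u)) at 2. simpl. unfold Cdiv; ring.
  - rewrite sum_Sn. rewrite step in IH. rewrite IH at 1. apply Cplus_assoc. }
destruct (circ_bounded f r) as [B [HB KB]]; [lra | intros u Hu; apply Hf; lra|].
set (M := (Cmod k * (4 * PI * (B * (r / (r - Cmod z)))))%R).
assert (HM : 0 <= M).
{ unfold M. apply Rmult_le_pos; [apply Cmod_ge_0|]. apply Rmult_le_pos; [lra|].
  apply Rmult_le_pos; [lra|]. apply Rlt_le, Rdiv_lt_0_compat; lra. }
set (x := (Cmod z / r)%R).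
assert (Hx : 0 <= x < 1).
{ unfold x; split; [apply Rdiv_le_0_compat; lra|].
  apply Rmult_lt_reg_r with r; [lra|]. unfold Rdiv. rewrite Rmult_assoc, Rinv_l; lra. }
assert (bound : forall n, (Cmod (k * circ_int (G n) r) <= M * x ^ n)%R).
{ intros n. rewrite Cmod_mult. unfold M. rewrite (Rmult_assoc (Cmod k)).
  apply Rmult_le_compat_l; [apply Cmod_ge_0|]. rewrite (Rmult_assoc (4 * PI)).
  apply circ_int_bound; [lra | now apply CG|]. intros t Ht.
  assert (Hu := Cmod_circ r t ltac:(lra)). specialize (KB t Ht). set (u := circ r t) in *.
  unfold G, Cdiv. rewrite !Cmod_mult, Cmod_pow, Cmod_mult, Cmod_inv by now apply N0. rewrite Hu. fold (Rdiv (Cmod z) r). fold x.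
  replace (B * (r / (r - Cmod z)) * x ^ n)%R with (B * x ^ n * (r * / (r - Cmod z)))%R by (unfold Rdiv; ring).
  assert (0 <= x ^ n) by (apply pow_le; lra).
  apply Rmult_le_compat.
  - apply Rmult_le_pos; [apply Cmod_ge_0 | assumption].
  - apply Rmult_le_pos; [lra | apply Cmod_ge_0]. 
  - now apply Rmult_le_compat_r.
  - apply Rmult_le_compat_l; [lra|]. apply Cmod_inv_le; [lra|]. rewrite <- Hu at 1. apply Cmod_minus_ge. }
apply is_series_of_remainder. intros e He.
destruct (pow_lt_1_zero x) with (y := (e / (M + 1))%R) as [N HN].
{ rewrite Rabs_pos_eq; lra. }
{ apply Rdiv_lt_0_compat; lra. }
exists N. intros n Hn. rewrite (rem n), Cmod_minus_sym.
match goal with |- Cmod (?s + ?t - ?s) < e => replace (s + t - s) with t by ring end.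
eapply Rle_lt_trans; [apply bound|].
specialize (HN (S n) ltac:(lia)). rewrite Rabs_pos_eq in HN by (apply pow_le; lra).
apply Rle_lt_trans with (M * (e / (M + 1)))%R.
- apply Rmult_le_compat_l; lra.
- apply Rmult_lt_reg_r with (M + 1)%R; [lra|].
  replace (M * (e / (M + 1)) * (M + 1))%R with (M * e)%R by (field; lra). nra.
Qed.

(** * Functions on the exterior disc *)

Lemma De_open (z w : C) : Cmod (w - z) < Cmod z - 1 -> D_e w.
Proof. unfold D_e. pose proof (Cmod_le_minus z w). rewrite Cmod_minus_sym in H. lra. Qed.

Lemma De_radius (z : C) : D_e z -> 0 < Cmod z - 1.
Proof. unfold D_e. lra. Qed.

Lemma holomorphic_De_differentiable (f : C -> C) :
  holomorphic_De f <-> forall z, D_e z -> differentiable_at f z.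
Proof.
split; intros H z Hz; destruct (H z Hz) as [d Hd]; exists d; now apply cder_is_derive.
Qed.

Lemma cder_ext_De (f g : C -> C) (z d : C) : D_e z ->
  (forall w, D_e w -> f w = g w) -> cder f z d -> cder g z d.
Proof.
intros Hz E. apply (cder_ext_loc f g z d (Cmod z - 1)); [now apply De_radius|].
intros w Hw. apply E. now apply De_open with z.
Qed.

(** [derivative_differentiable] gives a derivative function on each ball only; uniqueness of the
    derivative identifies all of them with [C_derive f]. *)
Lemma De_C_derive (f : C -> C) :
  (forall z, D_e z -> differentiable_at f z) ->
  forall z, D_e z -> cder f z (C_derive f z) /\ differentiable_at (C_derive f) z.
Proof.
intros Hf z Hz. pose proof (De_radius z Hz) as Hr.
destruct (derivative_differentiable f z (Cmod z - 1)) with (s := ((Cmod z - 1) / 2)%R) as [f' K].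
- intros w Hw. apply Hf. now apply De_open with z.
- lra.
- destruct (K z) as [K1 [D K2]]; [rewrite Cmod_minus_self; lra|]. split.
  + now rewrite (cder_C_derive _ _ _ K1).
  + exists D. apply (cder_ext_loc f' _ _ _ ((Cmod z - 1) / 2)); [lra | | assumption].
    intros w Hw. symmetry. apply cder_C_derive. now apply K.
Qed.

(** * Functions with zero derivative are constant *)

Lemma cder_line (f : C -> C) (z v : C) (t : R) (d : C) : cder f (z + t * v) d ->
  is_derive (fun s : R => Re (f (z + s * v))) t (Re (d * v)) /\
  is_derive (fun s : R => Im (f (z + s * v))) t (Im (d * v)).
Proof.
intros [p [Hp [Ed E]]].
assert (K : forall e, 0 < e -> exists r, 0 < r /\ forall h, h <> 0%R -> Rabs h < r ->
  Cmod ((f (z + (t + h)%R * v) - f (z + t * v)) / h - d * v) < e).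
{ intros e He. pose proof (Cmod_ge_0 v) as Pv.
  destruct (Hp (e / (Cmod v + 1))%R) as [r [Hr K]]; [apply Rdiv_lt_0_compat; lra|].
  exists (r / (Cmod v + 1))%R; split; [apply Rdiv_lt_0_compat; lra|]. intros h Nh Hh.
  assert (Nh' : RtoC h <> 0) by now apply RtoC_neq_0.
  assert (Eh : z + (t + h)%R * v - (z + t * v) = h * v) by (rewrite RtoC_plus; ring).
  rewrite (E (z + (t + h)%R * v)), Eh, <- Ed.
  replace ((f (z + t * v) + p (z + (t + h)%R * v) * (h * v) - f (z + t * v)) / h - p (z + t * v) * v)
    with ((p (z + (t + h)%R * v) - p (z + t * v)) * v) by (field; assumption).
  rewrite Cmod_mult.
  assert (Hq : Cmod (p (z + (t + h)%R * v) - p (z + t * v)) < e / (Cmod v + 1)).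
  { apply K. rewrite Eh, Cmod_mult, Cmod_R.
    apply Rle_lt_trans with (Rabs h * (Cmod v + 1))%R.
    - apply Rmult_le_compat_l; [apply Rabs_pos | lra].
    - apply Rlt_le_trans with (r / (Cmod v + 1) * (Cmod v + 1))%R.
      + apply Rmult_lt_compat_r; lra.
      + apply Req_le; field; lra. }
  apply Rle_lt_trans with (e / (Cmod v + 1) * Cmod v)%R.
  - apply Rmult_le_compat_r; [assumption | lra].
  - apply Rlt_le_trans with (e / (Cmod v + 1) * (Cmod v + 1))%R.
    + apply Rmult_lt_compat_l; [apply Rdiv_lt_0_compat; lra | lra].
    + apply Req_le; field; lra. }
assert (D : forall (a : C) (h : R), h <> 0%R -> a / h = ((Re a / h)%R, (Im a / h)%R)).
{ intros [a b] h Nh. unfold Cdiv, Cinv, Cmult, RtoC, Re, Im; simpl. f_equal; field; auto. }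
split; apply is_derive_Reals; intros e He; destruct (K e He) as [r [Hr K']]; exists (mkposreal r Hr);
intros h Nh Hh; specialize (K' h Nh Hh); rewrite D in K' by assumption.
- eapply Rle_lt_trans; [|exact K']. eapply Rle_trans; [|apply re_le_Cmod]. apply Req_le. reflexivity.
- eapply Rle_lt_trans; [|exact K']. eapply Rle_trans; [|apply Im_le_Cmod]. apply Req_le. reflexivity.
Qed.

Lemma constant_on_segment (f : C -> C) (z v : C) :
  (forall t : R, 0 <= t <= 1 -> cder f (z + t * v) 0) -> f (z + v) = f z.
Proof.
intros H.
assert (E : forall t : R, 0 <= t <= 1 ->
  is_derive (fun s : R => Re (f (z + s * v))) t 0%R /\ is_derive (fun s : R => Im (f (z + s * v))) t 0%R).
{ intros t Ht. generalize (cder_line f z v t 0 (H t Ht)). now rewrite Cmult_0_l. }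
assert (ER := @eq_is_derive R_NormedModule (fun s : R => Re (f (z + s * v))) 0 1 (fun t Ht => proj1 (E t Ht)) Rlt_0_1).
assert (EI := @eq_is_derive R_NormedModule (fun s : R => Im (f (z + s * v))) 0 1 (fun t Ht => proj2 (E t Ht)) Rlt_0_1).
cbv beta in ER, EI. rewrite Cmult_0_l, Cmult_1_l, Cplus_0_r in ER, EI.
destruct (f (z + v)), (f z). unfold Re, Im in ER, EI; simpl in ER, EI. now subst.
Qed.

Lemma constant_on_ball (f : C -> C) (z : C) (r : R) :
  (forall w, Cmod (w - z) < r -> cder f w 0) -> forall w, Cmod (w - z) < r -> f w = f z.
Proof.
intros H w Hw. replace w with (z + (w - z)) by ring. apply constant_on_segment.
intros t Ht. apply H. replace (z + t * (w - z) - z) with (t * (w - z)) by ring.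
rewrite Cmod_mult, Cmod_R, Rabs_pos_eq by lra. pose proof (Cmod_ge_0 (w - z)). nra.
Qed.

Definition dot (z w : C) : R := (Re z * Re w + Im z * Im w)%R.

Lemma De_plus_dot (z w : C) (t : R) : D_e z -> 0 <= dot z w -> 0 <= t -> D_e (z + t * w).
Proof.
intros Hz Hd Ht. unfold D_e in *. apply Rlt_le_trans with (1 := Hz).
unfold Cmod. apply sqrt_le_1_alt. unfold dot, Re, Im in Hd.
destruct z as [a b], w as [c d]; simpl in *.
assert (0 <= t * (a * c + b * d))%R by now apply Rmult_le_pos.
pose proof (Rle_0_sqr (t * c)); pose proof (Rle_0_sqr (t * d)); unfold Rsqr in *. nra.
Qed.

(* If [z] and [w] make an angle of at most 90 degrees, then [f z = f (z + w) = f w] along two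
   segments inside [D_e]; otherwise go through [Ci * z] or [- Ci * z]. *)
Lemma constant_on_De (f : C -> C) :
  (forall z, D_e z -> cder f z 0) -> forall z w, D_e z -> D_e w -> f z = f w.
Proof.
intros H.
assert (half : forall z w, D_e z -> 0 <= dot z w -> f (z + w) = f z).
{ intros z w Hz Hd. apply constant_on_segment. intros t Ht. apply H. now apply De_plus_dot. }
assert (acute : forall z w, D_e z -> D_e w -> 0 <= dot z w -> f z = f w).
{ intros z w Hz Hw Hd. rewrite <- (half z w), <- (half w z); auto.
  - f_equal; ring.
  - unfold dot in *; lra. }
assert (rot : forall c z, c = Ci \/ c = - Ci -> D_e z -> D_e (c * z) /\ 0 <= dot z (c * z)).
{ intros c z Hc Hz. split.
  - unfold D_e in *. rewrite Cmod_mult. destruct Hc as [-> | ->]; rewrite ?Cmod_opp, Cmod_Ci; lra.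
  - unfold dot, Re, Im, Ci, Cmult, Copp in *. destruct z as [x y].
    destruct Hc as [-> | ->]; simpl; lra. }
intros z w Hz Hw.
destruct (Rle_dec 0 (dot (Ci * z) w)) as [L|L].
- destruct (rot Ci z) as [R1 R2]; auto. rewrite (acute z (Ci * z)); auto.
- destruct (rot (- Ci) z) as [R1 R2]; auto. rewrite (acute z (- Ci * z)); auto.
  apply acute; auto. unfold dot, Re, Im, Ci, Cmult, Copp in *. simpl in *. lra.
Qed.

(** * Limits at a point and at infinity; partial derivatives *)

Lemma C_lim_ccont (f g : C -> C) (z : C) (r : R) : 0 < r ->
  (forall w, w <> z -> Cmod (w - z) < r -> f w = g w) -> ccont g z -> C_lim f z = g z.
Proof.
intros Hr E Hg. apply is_C_lim_unique. apply filterlim_locally. intros e.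
destruct (Hg e (cond_pos e)) as [d [Hd K]].
assert (Hm : 0 < Rmin d r) by now apply Rmin_pos.
match goal with |- locally' _ ?P => set (Q := P) end.
assert (W : forall w, w <> z -> Cmod (w - z) < Rmin d r -> Q w).
{ intros w N Hw. unfold Q. rewrite E; [|assumption | eapply Rlt_le_trans; [exact Hw | apply Rmin_r]].
  apply C_NormedModule_mixin_compat1. apply K. eapply Rlt_le_trans; [exact Hw | apply Rmin_l]. }
(* The balls behind [locally'] on [C] are squares; half the radius makes the square fit into the
   disc. *)
assert (Hm2 : 0 < Rmin d r / 2) by lra.
exists (mkposreal _ Hm2). intros w [H1 H2] N. apply W; [assumption|].
eapply Rle_lt_trans; [apply Cmod_le_Re_Im|].
change (Rabs (Re (w - z)) < Rmin d r / 2) in H1. change (Rabs (Im (w - z)) < Rmin d r / 2) in H2. lra.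
Qed.

Lemma tends_to_0_eps (f : C -> C) : tends_to_0_at_infty f ->
  forall e, 0 < e -> exists M, 0 < M /\ forall z, M < Cmod z -> Cmod (f z) < e.
Proof.
intros H e He.
destruct (H (fun y => Cmod y < e)) as [M K].
- assert (He2 : 0 < e / 2) by lra. exists (mkposreal _ He2). intros y [H1 H2].
  eapply Rle_lt_trans; [apply Cmod_le_Re_Im|].
  change (Rabs (fst y - 0) < e / 2) in H1. change (Rabs (snd y - 0) < e / 2) in H2.
  rewrite Rminus_0_r in H1, H2. unfold Re, Im. lra.
- exists (Rmax M 1). split.
  + apply Rlt_le_trans with 1%R; [lra | apply Rmax_r].
  + intros z Hz. apply K. eapply Rle_lt_trans; [apply Rmax_l | exact Hz].
Qed.

Lemma tends_to_0_ext_De (f g : C -> C) : (forall z, D_e z -> f z = g z) ->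
  tends_to_0_at_infty f -> tends_to_0_at_infty g.
Proof.
intros E. apply filterlim_ext_loc. exists 1%R. exact E.
Qed.

(** The differential is linear over [C], so on each coordinate axis it is multiplication by a
    constant, and there the product norm reduces to [Cmod]. *)
Lemma holomorphic_De2_partial (q : C -> C -> C) : holomorphic_De2 q ->
  forall z w, D_e z -> D_e w ->
  differentiable_at (fun t => q t w) z /\ differentiable_at (fun t => q z t) w.
Proof.
intros H z w Hz Hw. destruct (H z w Hz Hw) as [l [Ll Hl]].
specialize (Hl (z, w) (fun P HP => HP)).
assert (S1 : forall t : C, l (t, RtoC 0) = l (RtoC 1, RtoC 0) * t).
{ intros t. replace (t, RtoC 0) with (@scal _ C2_NormedModule t (RtoC 1, RtoC 0)).
  - rewrite (linear_scal l Ll). apply Cmult_comm.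
  - unfold scal; simpl. unfold prod_scal, scal; simpl. unfold mult; simpl.
    now rewrite Cmult_1_r, Cmult_0_r. }
assert (S2 : forall t : C, l (RtoC 0, t) = l (RtoC 0, RtoC 1) * t).
{ intros t. replace (RtoC 0, t) with (@scal _ C2_NormedModule t (RtoC 0, RtoC 1)).
  - rewrite (linear_scal l Ll). apply Cmult_comm.
  - unfold scal; simpl. unfold prod_scal, scal; simpl. unfold mult; simpl.
    now rewrite Cmult_1_r, Cmult_0_r. }
assert (N1 : forall t : C, @norm _ C2_NormedModule (t, RtoC 0) = Cmod t).
{ intros t. unfold norm; simpl. unfold prod_norm; simpl. unfold norm; simpl. unfold abs; simpl.
  rewrite Cmod_0. replace (Cmod t * (Cmod t * 1) + 0 * (0 * 1))%R with (Cmod t * Cmod t)%R by ring.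
  apply sqrt_square, Cmod_ge_0. }
assert (N2 : forall t : C, @norm _ C2_NormedModule (RtoC 0, t) = Cmod t).
{ intros t. unfold norm; simpl. unfold prod_norm; simpl. unfold norm; simpl. unfold abs; simpl.
  rewrite Cmod_0. replace (0 * (0 * 1) + Cmod t * (Cmod t * 1))%R with (Cmod t * Cmod t)%R by ring.
  apply sqrt_square, Cmod_ge_0. }
split.
- exists (l (RtoC 1, RtoC 0)). apply cder_of_bound. intros e He.
  destruct (Hl (mkposreal e He)) as [r K]. exists r; split; [apply cond_pos|]. intros t Ht.
  assert (Hb : @ball C2_NormedModule (z, w) r (t, w)).
  { split; [exact Ht | apply (ball_center (w : AbsRing_NormedModule C_AbsRing))]. }
  specialize (K (t, w) Hb). simpl in K.
  assert (M : @minus C2_NormedModule (t, w) (z, w) = (t - z, RtoC 0)).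
  { unfold minus, plus, opp; simpl. unfold prod_plus, prod_opp; simpl. unfold plus, opp; simpl.
    f_equal. apply Cplus_opp_r. }
  rewrite M, N1, S1 in K. exact K.
- exists (l (RtoC 0, RtoC 1)). apply cder_of_bound. intros e He.
  destruct (Hl (mkposreal e He)) as [r K]. exists r; split; [apply cond_pos|]. intros t Ht.
  assert (Hb : @ball C2_NormedModule (z, w) r (z, t)).
  { split; [apply (ball_center (z : AbsRing_NormedModule C_AbsRing)) | exact Ht]. }
  specialize (K (z, t) Hb). simpl in K.
  assert (M : @minus C2_NormedModule (z, t) (z, w) = (RtoC 0, t - w)).
  { unfold minus, plus, opp; simpl. unfold prod_plus, prod_opp; simpl. unfold plus, opp; simpl.
    f_equal. apply Cplus_opp_r. }
  rewrite M, N2, S2 in K. exact K.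
Qed.

(** * The Riccati equation *)

Lemma De_RtoC (x : R) : 1 < x -> D_e x.
Proof. intros H. unfold D_e. rewrite Cmod_R, Rabs_pos_eq; lra. Qed.

Lemma Cmult_reg_l (a b c : C) : a <> 0 -> a * b = a * c -> b = c.
Proof.
intros Ha H. rewrite <- (Cmult_1_l b), <- (Cmult_1_l c), <- (Cinv_l a) by assumption.
now rewrite <- !Cmult_assoc, H.
Qed.

Lemma d_z_cder (q : C -> C -> C) : holomorphic_De2 q -> forall z w, D_e z -> D_e w ->
  cder (fun t => q t w) z (d_z q z w) /\ cder (fun t => d_z q t w) z (d_z (d_z q) z w).
Proof.
intros Hq z w Hz Hw.
assert (H1 : forall t, D_e t -> differentiable_at (fun t => q t w) t).
{ intros t Ht. now apply holomorphic_De2_partial. }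
assert (H2 : forall t, D_e t -> differentiable_at (fun t => d_z q t w) t).
{ intros t Ht. now apply (De_C_derive (fun t => q t w)). }
split; [now apply (De_C_derive (fun t => q t w)) | now apply (De_C_derive (fun t => d_z q t w))].
Qed.

Lemma d_zz_ccont (q : C -> C -> C) : holomorphic_De2 q -> forall z w, D_e z -> D_e w ->
  ccont (fun t => d_z (d_z q) t w) z.
Proof.
intros Hq z w Hz Hw.
destruct (De_C_derive (fun t => d_z q t w)) with (z := z) as [_ [D H]]; [|assumption|].
- intros t Ht. eexists. now apply d_z_cder.
- now apply cder_ccont with D.
Qed.

(** The function [u_w] of the overview. The parameter [w] comes first so that [exp_secant q w] is
    the function of [z] to be differentiated. *)
Definition exp_secant (q : C -> C -> C) (w z : C) : C := Cexp (q z w) * (z - w).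

Definition exp_secant' (q : C -> C -> C) (w z : C) : C :=
  Cexp (q z w) * (d_z q z w * (z - w) + 1).

Definition exp_secant'' (q : C -> C -> C) (w z : C) : C :=
  Cexp (q z w) * (d_z q z w * (d_z q z w * (z - w) + 1)
                  + (d_z (d_z q) z w * (z - w) + d_z q z w)).

Lemma exp_secant_cder (q : C -> C -> C) : holomorphic_De2 q -> forall z w, D_e z -> D_e w ->
  cder (exp_secant q w) z (exp_secant' q w z) /\
  cder (exp_secant' q w) z (exp_secant'' q w z).
Proof.
intros Hq z w Hz Hw. destruct (d_z_cder q Hq z w Hz Hw) as [H1 H2].
assert (HE : cder (fun t => Cexp (q t w)) z (Cexp (q z w) * d_z q z w)).
{ apply (cder_comp (fun t => q t w) Cexp); [apply cder_Cexp | assumption]. }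
assert (HL : cder (fun t => t - w) z (1 - 0)) by (apply cder_minus; [apply cder_id | apply cder_const]).
split.
- apply (cder_eq _ _ (Cexp (q z w) * d_z q z w * (z - w) + Cexp (q z w) * (1 - 0))).
  { unfold exp_secant'; ring. }
  now apply (cder_mult (fun t => Cexp (q t w)) (fun t => t - w)).
- apply (cder_eq _ _ (Cexp (q z w) * d_z q z w * (d_z q z w * (z - w) + 1)
    + Cexp (q z w) * ((d_z (d_z q) z w * (z - w) + d_z q z w * (1 - 0)) + 0))).
  { unfold exp_secant''; ring. }
  apply (cder_mult (fun t => Cexp (q t w)) (fun t => d_z q t w * (t - w) + 1)); [assumption|].
  apply (cder_plus (fun t => d_z q t w * (t - w)) (fun _ => 1)); [|apply cder_const].
  now apply (cder_mult (fun t => d_z q t w) (fun t => t - w)).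
Qed.

Lemma exp_secant'_diag (q : C -> C -> C) (z : C) : exp_secant' q z z = Cexp (q z z).
Proof. unfold exp_secant'. ring. Qed.

(* Away from the diagonal this is the Riccati equation multiplied by [Cexp (q z w) * (z - w)]. *)
Definition secant_ode (q : C -> C -> C) : Prop :=
  forall z w, D_e z -> D_e w ->
    exp_secant'' q w z = 2 * oslash (d_z q) z * exp_secant' q w z.

(** Both sides are [2 * Cexp (q z z) * d_z q z z]: the coefficient [2 * oslash (d_z q)] is precisely
    the one that makes the linear equation hold on the diagonal. *)
Lemma secant_ode_diag (q : C -> C -> C) (z : C) :
  exp_secant'' q z z = 2 * oslash (d_z q) z * exp_secant' q z z.
Proof. unfold exp_secant'', exp_secant', oslash. ring. Qed.

Lemma riccati_secant_ode (q : C -> C -> C) : riccati q -> secant_ode q.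
Proof.
intros HR z w Hz Hw. destruct (Ceq_dec z w) as [->|N]; [apply secant_ode_diag|].
specialize (HR z w Hz Hw). unfold removable_quotient in HR.
destruct (Ceq_dec z w) as [|_]; [contradiction|].
assert (N' := Cminus_eq_contra _ _ N). unfold exp_secant'', exp_secant'.
unfold oslash in *. apply Ceq_minus.
match type of HR with ?X = _ => transitivity (Cexp (q z w) * (z - w) * X) end.
- simpl. field. assumption.
- rewrite HR. ring.
Qed.

(** [Q w] is the Riccati equation solved for the quotient. It agrees with the quotient off the
    diagonal and is continuous at [w], hence it is also the limit there. Continuity of
    [oslash (d_z q)] is assumed because it involves both variables of [d_z q] at once;
    [secant_riccati] obtains it from [psi]. *)
Lemma secant_ode_riccati (q : C -> C -> C) : holomorphic_De2 q ->
  (forall w, D_e w -> ccont (oslash (d_z q)) w) -> secant_ode q -> riccati q.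
Proof.
intros Hq HP HS.
set (Q := fun w z => - (d_z (d_z q) z w + d_z q z w ^ 2 - 2 * oslash (d_z q) z * d_z q z w) / 2).
assert (H2 : RtoC 2 <> 0) by (apply RtoC_neq_0; lra).
assert (off : forall z w, D_e z -> D_e w -> z <> w ->
  (d_z q z w - oslash (d_z q) z) / (z - w) = Q w z).
{ intros z w Hz Hw N. assert (N' := Cminus_eq_contra _ _ N).
  specialize (HS z w Hz Hw). unfold exp_secant'', exp_secant' in HS.
  set (P := oslash (d_z q) z) in *.
  assert (HS' : d_z q z w * (d_z q z w * (z - w) + 1) + (d_z (d_z q) z w * (z - w) + d_z q z w)
    = 2 * P * (d_z q z w * (z - w) + 1)).
  { apply (Cmult_reg_l (Cexp (q z w))); [apply Cexp_neq_0|]. rewrite HS. ring. }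
  apply Ceq_minus in HS'. apply Ceq_minus. unfold Q. fold P.
  match type of HS' with ?X = _ => transitivity (X / (2 * (z - w))) end.
  - simpl. field. auto.
  - rewrite HS'. field. auto. }
intros z w Hz Hw.
assert (E : removable_quotient (fun t => d_z q t w - oslash (d_z q) t) w z = Q w z).
{ unfold removable_quotient. destruct (Ceq_dec z w) as [->|N]; [|now apply off].
  apply (C_lim_ccont _ (Q w) w (Cmod w - 1)); [now apply De_radius | |].
  - intros t N Ht. apply off; auto. now apply De_open with w.
  - assert (C1 := d_zz_ccont q Hq w w Hw Hw).
    assert (C2 : ccont (fun t => d_z q t w) w) by (eapply cder_ccont; now apply d_z_cder).
    specialize (HP w Hw). unfold Q. apply ccont_div; [assumption | | apply ccont_const].
    apply ccont_opp. apply ccont_minus; [apply ccont_plus; [assumption | now apply ccont_pow]|].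
    apply ccont_mult; [|assumption]. apply ccont_mult; [apply ccont_const | assumption]. }
rewrite E. unfold Q. simpl. field.
Qed.

(** * From the logarithm of the difference quotient to the Riccati equation *)

Lemma log_diff_quotient_secant (psi : C -> C) (q : C -> C -> C) :
  (forall z w, D_e z -> D_e w -> Cexp (q z w) = diff_quotient psi z w) ->
  forall z w, D_e z -> D_e w -> exp_secant q w z = psi z - psi w.
Proof.
intros H z w Hz Hw. unfold exp_secant. rewrite H by assumption. unfold diff_quotient.
destruct (Ceq_dec z w) as [->|N]; [ring|]. field. now apply Cminus_eq_contra.
Qed.

(** The first two derivatives of [exp_secant q w] are those of [psi], hence independent of [w]. The
    linear equation for any [w] is therefore the case [w = z], which is the identity
    [secant_ode_diag]. *)
Lemma secant_riccati (psi : C -> C) (q : C -> C -> C) : holomorphic_De2 q ->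
  (forall z w, D_e z -> D_e w -> exp_secant q w z = psi z - psi w) -> riccati q.
Proof.
intros Hq HS.
assert (Hpsi : forall z w, D_e z -> D_e w -> cder psi z (exp_secant' q w z)).
{ intros z w Hz Hw. apply (cder_ext_De (fun t => exp_secant q w t + psi w)); [assumption | |].
  - intros t Ht. rewrite HS by assumption. ring.
  - apply (cder_eq _ _ (exp_secant' q w z + 0)); [ring|].
    apply (cder_plus (exp_secant q w) (fun _ => psi w)); [now apply exp_secant_cder | apply cder_const]. }
assert (Hd : forall z, D_e z -> differentiable_at psi z).
{ intros z Hz. eexists. now apply (Hpsi z z). }
assert (Hd' : forall z, D_e z -> differentiable_at (C_derive psi) z).
{ intros z Hz. now apply (De_C_derive psi). }
assert (E1 : forall z w, D_e z -> D_e w -> C_derive psi z = exp_secant' q w z).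
{ intros z w Hz Hw. apply cder_C_derive. now apply Hpsi. }
assert (E2 : forall z w, D_e z -> D_e w -> C_derive (C_derive psi) z = exp_secant'' q w z).
{ intros z w Hz Hw. apply cder_C_derive. apply (cder_ext_De (exp_secant' q w)); [assumption | |].
  - intros t Ht. symmetry. now apply E1.
  - now apply exp_secant_cder. }
assert (N1 : forall z, D_e z -> C_derive psi z <> 0).
{ intros z Hz. rewrite (E1 z z), exp_secant'_diag by assumption. apply Cexp_neq_0. }
assert (H2 : RtoC 2 <> 0) by (apply RtoC_neq_0; lra).
assert (EP : forall z, D_e z -> C_derive (C_derive psi) z / (2 * C_derive psi z) = oslash (d_z q) z).
{ intros z Hz. specialize (N1 z Hz). rewrite (E2 z z), secant_ode_diag, <- E1 by assumption. field. auto. }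
apply secant_ode_riccati; [assumption | |].
- intros w Hw. apply (ccont_ext_loc (fun z => C_derive (C_derive psi) z / (2 * C_derive psi z)) _ _ (Cmod w - 1)).
  + now apply De_radius.
  + intros z Hz. apply EP. now apply De_open with w.
  + destruct (De_C_derive (C_derive psi) Hd' w Hw) as [A [D B]].
    apply ccont_div; [apply Cmult_neq_0; auto | now apply cder_ccont with D |].
    apply ccont_mult; [apply ccont_const | eapply cder_ccont; exact A].
- intros z w Hz Hw. rewrite <- E1, <- E2, <- EP by assumption. specialize (N1 z Hz). field. auto.
Qed.

(** * From the Riccati equation to [psi] *)

Lemma ratio_cder_0 (a b : C -> C) (p z : C) : b z <> 0 ->
  cder a z (p * a z) -> cder b z (p * b z) -> cder (fun t => a t / b t) z 0.
Proof.
intros N Ha Hb. apply (cder_eq _ _ ((p * a z * b z - a z * (p * b z)) / (b z * b z))).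
- field. assumption.
- now apply cder_div.
Qed.

(* The zero set of [exp_secant' q w] is open: near [t] this function is a constant multiple of
   [exp_secant' q t], which does not vanish at [t].  This avoids the continuity of [oslash (d_z q)],
   i.e. of [d_z q] in both variables. *)
Lemma secant'_neq_0 (q : C -> C -> C) : holomorphic_De2 q -> secant_ode q ->
  forall w z, D_e w -> D_e z -> exp_secant' q w z <> 0.
Proof.
intros Hq HS w z Hw Hz.
assert (Hode : forall w z, D_e w -> D_e z ->
  cder (exp_secant' q w) z (2 * oslash (d_z q) z * exp_secant' q w z)).
{ intros u t Hu Ht. rewrite <- HS by assumption. now apply exp_secant_cder. }
(* Connectedness of [D_e] has the form of [constant_on_De], so it is applied to the indicator of the
   points where [exp_secant' q w] is non-zero. Being locally constant, this indicator has derivative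
   [0]. *)
set (ind := fun z => if Ceq_dec (exp_secant' q w z) 0 then RtoC 0 else RtoC 1).
assert (D : forall z, D_e z -> cder ind z 0).
{ intros t Ht.
  assert (L : exists r, 0 < r /\ forall u, Cmod (u - t) < r -> ind u = ind t).
  { destruct (Ceq_dec (exp_secant' q w t) 0) as [E|N].
    - destruct (ccont_neq (exp_secant' q t) t 0) as [r [Hr K]].
      + eapply cder_ccont. now apply Hode.
      + rewrite exp_secant'_diag. apply Cexp_neq_0.
      + pose proof (De_radius t Ht).
        exists (Rmin r (Cmod t - 1)); split; [now apply Rmin_pos|].
        assert (R1 : forall u, Cmod (u - t) < Rmin r (Cmod t - 1) -> exp_secant' q t u <> 0 /\ D_e u).
        { intros u Hu. split.
          - apply K. eapply Rlt_le_trans; [exact Hu | apply Rmin_l].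
          - apply De_open with t. eapply Rlt_le_trans; [exact Hu | apply Rmin_r]. }
        assert (R2 := constant_on_ball (fun u => exp_secant' q w u / exp_secant' q t u) t (Rmin r (Cmod t - 1))).
        intros u Hu. destruct (R1 u Hu) as [Nu Du].
        assert (EQ : exp_secant' q w u / exp_secant' q t u = 0).
        { rewrite R2; [|  | assumption].
          - rewrite E. unfold Cdiv. ring.
          - intros v Hv. destruct (R1 v Hv) as [Nv Dv].
            apply ratio_cder_0 with (2 * oslash (d_z q) v); auto. }
        assert (EU : exp_secant' q w u = 0).
        { replace (exp_secant' q w u) with (exp_secant' q w u / exp_secant' q t u * exp_secant' q t u) by (field; assumption).
          rewrite EQ. ring. }
        unfold ind. rewrite EU, E. reflexivity.
    - destruct (ccont_neq (exp_secant' q w) t 0) as [r [Hr K]]; [|assumption|].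
      + eapply cder_ccont. now apply Hode.
      + exists r; split; [assumption|]. intros u Hu. specialize (K u Hu). unfold ind.
        destruct (Ceq_dec (exp_secant' q w u) 0); [contradiction|].
        destruct (Ceq_dec (exp_secant' q w t) 0); [contradiction | reflexivity]. }
  destruct L as [r [Hr L]]. apply (cder_ext_loc (fun _ => ind t) _ _ _ r); [assumption | | apply cder_const].
  intros u Hu. symmetry. now apply L. }
(* A zero at [z] would force one at [w], where the value is [Cexp (q w w)]. *)
intros E. assert (B := constant_on_De ind D z w Hz Hw). unfold ind in B.
destruct (Ceq_dec (exp_secant' q w z) 0) as [_|]; [|contradiction].
destruct (Ceq_dec (exp_secant' q w w) 0) as [E'|_].
- rewrite exp_secant'_diag in E'. now apply (Cexp_neq_0 (q w w)).
- apply C1_nz. now symmetry.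
Qed.

(* [exp_secant q w] in the coordinate [t = / z] at infinity, made regular by the factor [t]. *)
Definition secant_at_infty (q : C -> C -> C) (w t : C) : C :=
  if Ceq_dec t 0 then 1 else t * exp_secant q w (/ t).

Lemma secant_at_infty_0 (q : C -> C -> C) (w : C) : secant_at_infty q w 0 = 1.
Proof. unfold secant_at_infty. destruct (Ceq_dec 0 0); congruence. Qed.

Lemma Cinv_De (t : C) : t <> 0 -> Cmod t < 1 -> D_e (/ t).
Proof.
intros N H. unfold D_e. rewrite Cmod_inv by assumption. rewrite <- Rinv_1.
apply Rinv_lt_contravar; [|assumption]. rewrite Rmult_1_r. now apply Cmod_gt_0.
Qed.

Lemma secant_at_infty_ccont (q : C -> C -> C) (w : C) :
  tends_to_0_at_infty (fun z => q z w) -> ccont (secant_at_infty q w) 0.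
Proof.
intros H.
set (h := fun t => if Ceq_dec t 0 then RtoC 0 else q (/ t) w).
assert (Hh : ccont h 0).
{ intros e He. destruct (tends_to_0_eps _ H e He) as [M [HM K]].
  exists (/ M)%R. split; [now apply Rinv_0_lt_compat|]. intros t Ht.
  replace (t - 0) with t in Ht by ring. unfold h. destruct (Ceq_dec 0 0) as [_|]; [|congruence].
  destruct (Ceq_dec t 0) as [E|N]; [now rewrite Cmod_minus_self|].
  replace (q (/ t) w - 0) with (q (/ t) w) by ring. apply K.
  rewrite Cmod_inv by assumption. rewrite <- (Rinv_inv M). apply Rinv_lt_contravar; [|assumption].
  apply Rmult_lt_0_compat; [now apply Cmod_gt_0 | now apply Rinv_0_lt_compat]. }
(* For [t <> 0], [t * exp_secant q w (/ t) = Cexp (q (/ t) w) * (1 - w * t)], and the right-hand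
   side has the limit [1]. *)
apply (ccont_ext_loc (fun t => Cexp (h t) * (1 - w * t)) _ _ 1); [lra | |].
- intros t _. unfold secant_at_infty, h, exp_secant. destruct (Ceq_dec t 0) as [->|N].
  + rewrite Cexp_0. ring.
  + field. assumption.
- apply ccont_mult.
  + apply (ccont_comp h Cexp); [|assumption]. eapply cder_ccont, cder_Cexp.
  + apply ccont_minus; [apply ccont_const|]. apply ccont_mult; [apply ccont_const | apply ccont_id].
Qed.

Lemma ccont_eq_0 (f : C -> C) : ccont f 0 ->
  (forall t : C, t <> 0 -> Cmod t < 1 -> f t = 0) -> f 0 = 0.
Proof.
intros Hf H. destruct (Ceq_dec (f 0) 0) as [|N]; [assumption|exfalso].
destruct (ccont_neq f 0 0 Hf N) as [d [Hd K]].
set (x := (Rmin d 1 / 2)%R).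
assert (0 < Rmin d 1) by (apply Rmin_pos; lra).
pose proof (Rmin_l d 1). pose proof (Rmin_r d 1).
assert (Hx : Cmod (RtoC x) = x) by (rewrite Cmod_R; apply Rabs_pos_eq; unfold x; lra).
apply (K (RtoC x)).
- replace (RtoC x - 0) with (RtoC x) by ring. rewrite Hx. unfold x; lra.
- apply H; [apply RtoC_neq_0 | rewrite Hx]; unfold x; lra.
Qed.

Lemma secant_ode_difference (q : C -> C -> C) : holomorphic_De2 q -> secant_ode q ->
  (forall w, D_e w -> tends_to_0_at_infty (fun z => q z w)) ->
  forall z w w0, D_e z -> D_e w -> D_e w0 ->
  exp_secant q w z = exp_secant q w0 z - exp_secant q w0 w.
Proof.
intros Hq HS Hinf z w w0 Hz Hw Hw0.
assert (NZ := secant'_neq_0 q Hq HS).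
assert (Hode : forall w z, D_e w -> D_e z ->
  cder (exp_secant' q w) z (2 * oslash (d_z q) z * exp_secant' q w z)).
{ intros u t Hu Ht. rewrite <- HS by assumption. now apply exp_secant_cder. }
set (c := exp_secant' q w z / exp_secant' q w0 z).
assert (E1 : forall t, D_e t -> exp_secant' q w t = c * exp_secant' q w0 t).
{ intros t Ht. assert (N := NZ w0 t Hw0 Ht).
  assert (B := constant_on_De (fun t => exp_secant' q w t / exp_secant' q w0 t)).
  cbv beta in B. unfold c. rewrite (B) with (z := z) (w := t); auto.
  - field. assumption.
  - intros u Hu. apply ratio_cder_0 with (2 * oslash (d_z q) u); auto. }
set (d := exp_secant q w z - c * exp_secant q w0 z).
assert (E2 : forall t, D_e t -> exp_secant q w t - c * exp_secant q w0 t = d).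
{ intros t Ht. apply (constant_on_De (fun t => exp_secant q w t - c * exp_secant q w0 t)); auto.
  intros u Hu. apply (cder_eq _ _ (exp_secant' q w u - (0 * exp_secant q w0 u + c * exp_secant' q w0 u))).
  { rewrite (E1 u Hu). ring. }
  apply (cder_minus (exp_secant q w) (fun t => c * exp_secant q w0 t)); [now apply exp_secant_cder|].
  apply (cder_mult (fun _ => c) (exp_secant q w0)); [apply cder_const | now apply exp_secant_cder]. }
(* In the coordinate [t = / z], relation [E2] multiplied by [t] says that the two regularized
   secants satisfy [secant_at_infty q w t - c * secant_at_infty q w0 t = d * t]; letting [t] tend to
   [0] gives [1 - c = 0]. *)
assert (Ec : c = 1).
{ assert (Z := ccont_eq_0 (fun t => secant_at_infty q w t - c * secant_at_infty q w0 t - d * t)).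
  cbv beta in Z. rewrite !secant_at_infty_0 in Z.
  symmetry. apply Ceq_minus. transitivity (1 - c * 1 - d * 0); [ring|]. apply Z.
  - apply ccont_minus; [apply ccont_minus|]; [now apply secant_at_infty_ccont, Hinf | |].
    + apply ccont_mult; [apply ccont_const | now apply secant_at_infty_ccont, Hinf].
    + apply ccont_mult; [apply ccont_const | apply ccont_id].
  - intros t N Ht. unfold secant_at_infty. destruct (Ceq_dec t 0) as [|_]; [contradiction|].
    rewrite <- (E2 (/ t)); [ring|]. now apply Cinv_De. }
rewrite Ec in E2.
(* At the point [w] the function [exp_secant q w] vanishes, which identifies [d] as
   [- exp_secant q w0 w]. *)
assert (Ez := E2 z Hz). assert (Ew := E2 w Hw). unfold exp_secant at 1 in Ew.
transitivity (exp_secant q w0 z + (exp_secant q w z - 1 * exp_secant q w0 z)); [ring|].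
rewrite Ez, <- Ew. ring.
Qed.

(** The exponentials agree because [psi z - psi w] and [z - w] both change sign under the exchange.
    To pass to the logarithms, [q t w - q w t] is shown to have derivative [0] in [t]; it vanishes
    at [t = w]. Decay in the second variable then follows from decay in the first. *)
Lemma secant_symmetric (psi : C -> C) (q : C -> C -> C) : holomorphic_De2 q ->
  (forall z w, D_e z -> D_e w -> exp_secant q w z = psi z - psi w) ->
  forall z w, D_e z -> D_e w -> q z w = q w z.
Proof.
intros Hq HS z w Hz Hw.
assert (E : forall t, D_e t -> Cexp (q t w) = Cexp (q w t)).
{ intros t Ht. destruct (Ceq_dec t w) as [->|N]; [reflexivity|].
  apply (Cmult_reg_l (t - w)); [now apply Cminus_eq_contra|].
  transitivity (exp_secant q w t); [unfold exp_secant; ring|].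
  transitivity (- exp_secant q t w); [|unfold exp_secant; ring].
  rewrite !HS by assumption. ring. }
assert (D : forall t, D_e t -> cder (fun t => q t w - q w t) t 0).
{ intros t Ht. destruct (holomorphic_De2_partial q Hq t w Ht Hw) as [[a Ha] _].
  destruct (holomorphic_De2_partial q Hq w t Hw Ht) as [_ [b Hb]].
  apply (cder_eq _ _ (a - b)); [|now apply cder_minus].
  enough (a = b) as -> by ring.
  apply (Cmult_reg_l (Cexp (q t w))); [apply Cexp_neq_0|].
  apply (cder_unique (fun t => Cexp (q t w)) t).
  - apply (cder_comp (fun t => q t w) Cexp); [apply cder_Cexp | assumption].
  - rewrite E by assumption. apply (cder_ext_De (fun t => Cexp (q w t))); [assumption | |].
    + intros u Hu. symmetry. now apply E.
    + apply (cder_comp (fun t => q w t) Cexp); [apply cder_Cexp | assumption]. }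
assert (B := constant_on_De _ D z w Hz Hw). cbv beta in B.
apply Ceq_minus. rewrite B. ring.
Qed.

Lemma exp_secant_class_Sigma (q : C -> C -> C) (w : C) : holomorphic_De2 q -> D_e w ->
  tends_to_0_at_infty (fun z => q z w) -> univalent_De (exp_secant q w) ->
  class_Sigma (exp_secant q w).
Proof.
intros Hq Hw Hinf Hu. split; [assumption|].
destruct (taylor_series (secant_at_infty q w) 1) as [c [Hc0 Hc]]; [lra | | |].
2: { intros t Ht Nt.
  destruct (exp_secant_cder q Hq (/ t) w) as [D _]; [now apply Cinv_De | assumption|].
  eexists. apply (cder_ext_loc (fun t => t * exp_secant q w (/ t)) _ _ _ (Cmod t)).
  - now apply Cmod_gt_0.
  - intros u Hut. unfold secant_at_infty. destruct (Ceq_dec u 0) as [->|]; [|reflexivity].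
    replace (0 - t) with (- t) in Hut by ring. rewrite Cmod_opp in Hut. lra.
  - apply cder_mult; [apply cder_id|]. apply (cder_comp Cinv (exp_secant q w)); [exact D|].
    now apply cder_inv. }
{ intros t Ht. destruct (Ceq_dec t 0) as [->|Nt]; [now apply secant_at_infty_ccont|].
  destruct (exp_secant_cder q Hq (/ t) w) as [D _]; [now apply Cinv_De | assumption|].
  apply (ccont_ext_loc (fun t => t * exp_secant q w (/ t)) _ _ (Cmod t)).
  - now apply Cmod_gt_0.
  - intros u Hut. unfold secant_at_infty. destruct (Ceq_dec u 0) as [->|]; [|reflexivity].
    replace (0 - t) with (- t) in Hut by ring. rewrite Cmod_opp in Hut. lra.
  - apply ccont_mult; [apply ccont_id|]. apply (ccont_comp Cinv (exp_secant q w)).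
    + eapply cder_ccont. exact D.
    + now apply ccont_inv. }
(* Multiplying the expansion of [t * psi (/ t)] at [t = / z] by [z] gives
   [psi z = c 0 * z + c 1 + c 2 / z + ...]; since [c 0 = 1], the first term is the [z] that
   [class_Sigma] subtracts, and the indices shift by one. *)
exists (fun n => c (S n)). intros z Hz.
assert (Nz : z <> 0) by (intros ->; unfold D_e in Hz; rewrite Cmod_0 in Hz; lra).
assert (Hz1 : Cmod (/ z) < 1).
{ rewrite Cmod_inv by assumption. rewrite <- Rinv_1. apply Rinv_lt_contravar; [|exact Hz].
  unfold D_e in Hz; lra. }
specialize (Hc (/ z) Hz1). unfold secant_at_infty in Hc at 1.
assert (Nz' : / z <> 0).
{ intros E. apply C1_nz. rewrite <- (Cinv_r z) by assumption. rewrite E. ring. }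
destruct (Ceq_dec (/ z) 0) as [|_]; [contradiction|].
replace (/ / z) with z in Hc by (field; auto).
assert (L0 : / z * exp_secant q w z
  = @plus C_NormedModule (/ z * exp_secant q w z - 1) (c 0%nat * (/ z) ^ 0)).
{ change (/ z * exp_secant q w z = / z * exp_secant q w z - 1 + c 0%nat * (/ z) ^ 0).
  rewrite Hc0, secant_at_infty_0. simpl. ring. }
rewrite L0 in Hc.
apply (is_series_incr_1 (fun n => c n * (/ z) ^ n : C_NormedModule)) in Hc.
apply (is_series_scal z) in Hc.
assert (L : @scal _ C_NormedModule z (/ z * exp_secant q w z - 1) = exp_secant q w z - z).
{ change (z * (/ z * exp_secant q w z - 1) = exp_secant q w z - z). field. assumption. }
rewrite L in Hc. revert Hc. apply is_series_ext. intros n.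
change (z * (c (S n) * (/ z) ^ S n) = c (S n) / z ^ n).
rewrite Cpow_S, Cpow_inv by assumption. field. auto using Cpow_nz.
Qed.

Theorem theorem3p5 (q : C -> C -> C) (Hq : holomorphic_De2 q) :
  (exists psi : C -> C, class_Sigma psi /\
     exists L : C -> C -> C, is_log_diff_quotient psi L /\
       forall z w : C, D_e z -> D_e w -> q z w = L z w)
  <->
  (forall w : C, D_e w -> tends_to_0_at_infty (fun z => q z w)) /\
  riccati q.
Proof.
split.
- intros [psi [_ [L [[_ [HE [Hinf _]]] HqL]]]]. split.
  + intros w Hw. apply (tends_to_0_ext_De (fun z => L z w)); [|now apply Hinf].
    intros z Hz. symmetry. now apply HqL.
  + apply (secant_riccati psi); [assumption|]. apply log_diff_quotient_secant.
    intros z w Hz Hw. rewrite HqL by assumption. now apply HE.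
- intros [Hinf HR]. assert (HS := riccati_secant_ode q HR).
  assert (H2 : D_e 2) by (apply De_RtoC; lra).
  (* The base point [2] is an arbitrary element of [D_e]: by [secant_ode_difference], another choice
     changes [psi] by an additive constant. *)
  set (psi := exp_secant q 2).
  assert (K : forall z w, D_e z -> D_e w -> exp_secant q w z = psi z - psi w).
  { intros z w Hz Hw. now apply secant_ode_difference. }
  assert (Hpsi : forall z, D_e z -> cder psi z (Cexp (q z z))).
  { intros z Hz. rewrite <- exp_secant'_diag.
    apply (cder_ext_De (fun t => exp_secant q z t + psi z)); [assumption | |].
    - intros t Ht. rewrite K by assumption. ring.
    - apply (cder_eq _ _ (exp_secant' q z z + 0)); [ring|].
      apply (cder_plus (exp_secant q z) (fun _ => psi z)); [now apply exp_secant_cder | apply cder_const]. }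
  exists psi. split.
  + apply exp_secant_class_Sigma; auto. split.
    * apply holomorphic_De_differentiable. intros z Hz. eexists. now apply Hpsi.
    (* If [psi z = psi w], then [Cexp (q z w) * (z - w) = 0], and the exponential has no zeros. *)
    * intros z w Hz Hw E. destruct (Ceq_dec z w) as [|N]; [assumption|exfalso].
      specialize (K z w Hz Hw). unfold psi in K. rewrite E in K.
      revert K. replace (exp_secant q 2 w - exp_secant q 2 w) with (RtoC 0) by ring.
      apply Cmult_neq_0; [apply Cexp_neq_0 | now apply Cminus_eq_contra].
  (* The branch is [q] itself: its exponential is the difference quotient, which on the diagonal is
     [psi' z = Cexp (q z z)], and it decays in both variables. *)
  + exists q. split; [|reflexivity]. split; [assumption|]. split; [|split].
    * intros z w Hz Hw. unfold diff_quotient. destruct (Ceq_dec z w) as [<-|N].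
      -- symmetry. apply cder_C_derive. now apply Hpsi.
      -- rewrite <- K by assumption. unfold exp_secant. field. now apply Cminus_eq_contra.
    * assumption.
    * intros z Hz. apply (tends_to_0_ext_De (fun w => q w z)); [|now apply Hinf].
      intros w Hw. now apply (secant_symmetric psi).
Qed.
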